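(* Let $\Sigma$ be a smooth compact torus, $0<T\le\infty$, and let $F\colon[0,T)\times\Sigma\to\mathbb S^3$ be a smooth solution of the Möbius-invariant Willmore flow (MIWF) with $F_t=F(t,\cdot)$, area measures $\mu_t$ on $\Sigma$, $W(t)=\mathcal W(F_t)$, $W_0=W(0)$. Assume $\inf_{0<t<T}\min_{x\in\Sigma}|A_t^0(x)|^2\geq c_0>0$. Then for every $0<s<t<T$ $$\lVert\mu_t-\mu_s\rVert_{\mathrm{TV}}\leq\frac{2\sqrt{W_0}}{c_0}\sqrt{(t-s)\bigl(W(s)-W(t)\bigr)} .$$ In particular, for every Borel set $B\subset\Sigma$, $$|\mu_t(B)-\mu_s(B)|\leq\frac{2\sqrt{W_0}}{c_0}\sqrt{(t-s)\bigl(W(s)-W(t)\bigr)} .$$ If $W_0\leq8\pi$, the constant $2\sqrt{W_0}/c_0$ in both estimates may be replaced by $\sqrt{32\pi}/c_0$.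
   Context: $\mathbb S^3\subset\mathbb R^4$ is the unit sphere with round metric $g_{\mathbb S^3}$. For a smooth immersion $F_t\colon\Sigma\to\mathbb S^3$: $g_t:=F_t^*g_{\mathbb S^3}$, $\mu_t$ is its area measure, and $A_t,A_t^0,H_t$ are the second fundamental form, its trace-free part, and the trace mean-curvature vector of $F_t$ in $\mathbb S^3$; norms are with respect to $g_t$ and $g_{\mathbb S^3}$. $\mathcal W(F_t)=\int_\Sigma(1+\frac14|H_t|^2)\,\mathrm d\mu_t$. The $L^2$-gradient $G_t$ is the normal field with $D\mathcal W(F_t)[\phi]=\int_\Sigma\langle G_t,\phi\rangle\,\mathrm d\mu_t$ for all smooth normal fields $\phi$. A smooth MIWF is a smooth family of umbilic-free immersions satisfying $\partial_tF_t=-|A_t^0|^{-4}G_t$. For a signed Radon measure $\sigma$ on $\Sigma$, $\lVert\sigma\rVert_{\mathrm{TV}}:=|\sigma|(\Sigma)=\sup\{|\int\psi\,\mathrm d\sigma|:\psi\in C^0(\Sigma),\lVert\psi\rVert_{L^\infty}\le1\}$. *)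

(* Defs.v *)
From HB Require Import structures.
From mathcomp Require Import all_boot all_order all_algebra.
From mathcomp Require Import all_classical all_reals all_analysis.

Set Implicit Arguments.
Unset Strict Implicit.
Unset Printing Implicit Defensive.

Import Order.TTheory GRing.Theory Num.Theory.
Import numFieldNormedType.Exports.

Local Open Scope classical_set_scope.
Local Open Scope ring_scope.

Section Smoothness.
Context {R : realType} {V W : normedModType R}.

Fixpoint iter_derive (vs : seq V) (f : V -> W) : V -> W :=
  if vs is v :: vs' then 'D_v (iter_derive vs' f) else f.

(* On an open subset of a finite-dimensional space this is C^oo: directional
   derivatives of all orders exist and are continuous. *)
Definition smooth_on_open (U : set V) (f : V -> W) : Prop :=
  forall (vs : seq V) (x : V), U x ->
    (forall v, derivable (iter_derive vs f) x v) /\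
    {for x, continuous (iter_derive vs f)}.

(* On an arbitrary subset: local existence of smooth extensions. It is used for
   [0, T) x R^2, where it means smoothness up to the initial time. *)
Definition smooth_on (A : set V) (f : V -> W) : Prop :=
  forall a, A a -> exists (U : set V) (g : V -> W),
    [/\ open U, U a, smooth_on_open U g &
        forall x, A x -> U x -> g x = f x].

End Smoothness.

(* A smooth compact torus S is presented by its universal covering
   p : R^2 -> S, the composition of R^2 -> R^2/Z^2 with a diffeomorphism
   R^2/Z^2 -> S. Thus S carries the quotient topology, a map f on S is smooth
   iff f \o p is, and p is a chart around every point of R^2. *)
Record torus_covering {R : realType} {S : ptopologicalType} (p : R * R -> S)
    : Prop := TorusCovering {
  covering_surj : forall x : S, exists u, p u = x ;
  covering_fiber : forall u v : R * R,
    p u = p v <-> exists m n : int, u.1 - v.1 = m%:~R /\ u.2 - v.2 = n%:~R ;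
  covering_open : forall U : set S, open U <-> open (p @^-1` U) }.

Definition borel (S : ptopologicalType) := g_sigma_algebraType (@open S).

Section LocalGeometry.
Context {R : realType}.
Implicit Types (X : R * R -> 'rV[R]_4) (u : R * R) (w : 'rV[R]_4) (i j : 'I_2).

Definition dot w1 w2 : R := \sum_k w1 0 k * w2 0 k.

Definition partial i X : R * R -> 'rV[R]_4 :=
  'D_(if i == 0 then (1, 0) else (0, 1) : R * R) X.

Definition metric X u : 'M[R]_2 :=
  \matrix_(i, j) dot (partial i X u) (partial j X u).

Definition cometric X u : 'M[R]_2 := invmx (metric X u).

Definition area_density X u : R := Num.sqrt (\det (metric X u)).

(* Orthogonal projection of R^4 onto the normal space of the surface in S^3,
   i.e. onto the orthogonal complement of X, d_1 X, d_2 X (with |X| = 1). *)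
Definition normal_part X u w : 'rV[R]_4 :=
  w - dot w (X u) *: X u
    - \sum_i \sum_j
        (cometric X u i j * dot w (partial i X u)) *: partial j X u.

(* The Levi-Civita connection of S^3 is the projection of the flat one, so the
   normal part of d_i d_j X is the second fundamental form in S^3. *)
Definition second_ff X u i j : 'rV[R]_4 :=
  normal_part X u (partial i (partial j X) u).

Definition mean_curvature X u : 'rV[R]_4 :=
  \sum_i \sum_j cometric X u i j *: second_ff X u i j.

Definition tracefree_ff X u i j : 'rV[R]_4 :=
  second_ff X u i j - (metric X u i j / 2) *: mean_curvature X u.

Definition sqnorm_tracefree X u : R :=
  \sum_i \sum_j \sum_k \sum_l
    cometric X u i k * cometric X u j l *
    dot (tracefree_ff X u i j) (tracefree_ff X u k l).

End LocalGeometry.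

Section Willmore.
Context {R : realType} {S : ptopologicalType} (p : R * R -> S).
Implicit Types (f phi G : S -> 'rV[R]_4) (x : S).

Definition immersion f : Prop :=
  [/\ smooth_on setT (f \o p),
      forall x, dot (f x) (f x) = 1 &
      forall u v, 'D_v (f \o p) u = 0 -> v = 0].

(* Some preimage of x; geometric quantities do not depend on the choice, as
   the preimages of x differ by a period of f \o p. *)
Definition covering_lift x : R * R := xget (0, 0) [set u | p u = x].

Definition sqH f x : R :=
  let h := mean_curvature (f \o p) (covering_lift x) in dot h h.

Definition sqA0 f x : R := sqnorm_tracefree (f \o p) (covering_lift x).

Definition unit_square : set (R * R) := `[0, 1[%classic `*` `[0, 1[%classic.

(* The unit square is a fundamental domain of p. This set function is a measure
   when p is a torus covering and f \o p is smooth. *)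
Definition area_measure f (B : set (borel S)) : \bar R :=
  (\int[lebesgue_measure \x lebesgue_measure]_(u in
      unit_square `&` p @^-1` B)
    (area_density (f \o p) u)%:E)%E.

Definition willmore f : R :=
  fine (\int[area_measure f]_(x in [set: borel S])
          (1 + sqH f x / 4)%:E)%E.

Definition normal_field f phi : Prop :=
  [/\ smooth_on setT (phi \o p),
      forall x, dot (phi x) (f x) = 0 &
      forall u v, dot (phi (p u)) ('D_v (f \o p) u) = 0].

Definition smooth_variation f phi (V : R -> S -> 'rV[R]_4) : Prop :=
  exists2 d : R, 0 < d &
  [/\ smooth_on [set z : R * (R * R) | `|z.1| < d]
        (fun z => V z.1 (p z.2)),
      forall e, `|e| < d -> immersion (V e),
      V 0 = f &
      forall x, is_derive (0 : R) (1 : R) (fun e => V e x) (phi x)].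

(* D W(f)[phi] is the derivative of W along any curve of immersions through f
   with velocity phi. *)
Definition is_L2_gradient f G : Prop :=
  normal_field f G /\
  forall phi, normal_field f phi ->
  forall V, smooth_variation f phi V ->
    is_derive (0 : R) (1 : R) (fun e => willmore (V e))
      (fine (\int[area_measure f]_(x in [set: borel S])
               (dot (G x) (phi x))%:E)%E).

(* The filter makes the time derivative two-sided for t > 0 and one-sided at
   t = 0. *)
Definition is_MIWF (T : \bar R) (F : R -> S -> 'rV[R]_4) : Prop :=
  [/\ smooth_on [set z : R * (R * R) | 0 <= z.1 /\ (z.1%:E < T)%E]
        (fun z => F z.1 (p z.2)),
      forall t, 0 <= t -> (t%:E < T)%E ->
        immersion (F t) /\ (forall x, sqA0 (F t) x != 0) &
      exists G : R -> S -> 'rV[R]_4,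
        forall t, 0 <= t -> (t%:E < T)%E ->
          is_L2_gradient (F t) (G t) /\
          forall x,
            h^-1 *: (F (t + h) x - F t x) @[h --> within [set h | 0 <= t + h] 0^']
              --> - ((sqA0 (F t) x) ^- 2 *: G t x)].

(* Total variation of the signed measure mu - nu. *)
Definition TV_dist (mu nu : set (borel S) -> \bar R) : \bar R :=
  ereal_sup [set `| \int[mu]_(x in [set: borel S]) (psi x)%:E
                    - \int[nu]_(x in [set: borel S]) (psi x)%:E |%E |
             psi in [set psi : S -> R |
                       continuous psi /\ forall x, `|psi x| <= 1]].

End Willmore.

(* Main.v *)
Require Import Defs.
From HB Require Import structures.
From mathcomp Require Import all_boot all_order all_algebra.
From mathcomp Require Import all_classical all_reals all_analysis.
From mathcomp Require Import measurable_realfun ring lra.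

Set Implicit Arguments.
Unset Strict Implicit.
Unset Printing Implicit Defensive.

Import Order.TTheory GRing.Theory Num.Theory.
Import numFieldNormedType.Exports.

Local Open Scope classical_set_scope.
Local Open Scope ring_scope.

(** Write [v = d_t F = - |A0|^-4 G] for the velocity of the flow, [rho] for the
    area density in the covering plane, and [Q] for the unit square. Two formulas
    carry the proof. The first variation of area is

      d_t rho = - <v, H> rho

    because [v] is normal ([area_density_rateE]). The definition of the gradient,
    tested with the flow itself, gives

      W' = int <G, v> dmu = - int |A0|^-4 |G|^2 dmu <= 0

    ([is_derive_willmore]). Since |A0|^2 >= c0, one has
    |v|^2 <= - c0^-2 <G, v>, and the weighted arithmetic-geometric mean inequality
    yields, for every l > 0,

      |<v, H>| <= (2 c0)^-1 (l |H|^2 - l^-1 <G, v>).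

    Let [sigma] be a measurable weight on [Q] with |sigma| <= 1, and let [I(t)] be
    the integral of sigma rho over [Q]. As |H|^2 <= 4 (1 + |H|^2 / 4), integration
    gives

      |I'(t)| <= (2 c0)^-1 (4 l W(t) - l^-1 W'(t)),   W(t) <= W(0).

    Both sides are derivatives of explicit functions of time up to the bound
    W <= W(0), so they can be compared by monotonicity at the ends of the interval;
    minimising over [l] afterwards gives

      |I(t) - I(s)| <= 2 sqrt(W(0)) / c0 * sqrt((t - s) (W(s) - W(t)))

    ([dissipation_estimate], [weighted_area_estimate]). The choice
    sigma = psi o p with psi continuous gives the total variation bound, and the
    indicator of the preimage of [B] the bound for a Borel set [B].

    The bound W(t) <= W(0) needs the energy to be right continuous at time zero,
    where the gradient only speaks of two-sided variations. The family F(e^2)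
    is such a variation of F(0), with velocity zero ([squared_variation]); hence
    W(e^2) is differentiable, and in particular continuous, at e = 0.

    The remaining work is foundational: symmetry of mixed second derivatives and
    stability of smoothness under a change of time, both with directional
    derivatives; the 2 x 2 linear algebra of the metric; and the formula for
    integrals against [area_measure], which is the image under the covering of a
    measure with density ([integral_area_measure]). *)

(** * Directional derivatives *)

(** A directional derivative only sees a map along one line. Hence maps that
    agree along corresponding lines have the same derivative there; slices,
    translations and restrictions to lines are all instances. *)
Section Transport.
Context {R : realType} {V V' W : normedModType R}.
Variables (f : V -> W) (f' : V' -> W) (x v : V) (x' v' : V').
Hypothesis same_line : forall h : R, f' (h *: v' + x') = f (h *: v + x).

Let same_quotient :
  (fun h : R => h^-1 *: ((f' \o shift x') (h *: v') - f' x')) =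
  (fun h : R => h^-1 *: ((f \o shift x) (h *: v) - f x)).
Proof.
have := same_line 0; rewrite !scale0r !add0r => fx.
by apply/funext => h; rewrite /= same_line fx.
Qed.

Lemma derive_transport : 'D_v' f' x' = 'D_v f x.
Proof. by rewrite /derive same_quotient. Qed.

Lemma derivable_transport : derivable f' x' v' = derivable f x v.
Proof. by rewrite /derivable same_quotient. Qed.

Lemma is_derive_transport d : is_derive x v f d -> is_derive x' v' f' d.
Proof.
move=> [fxv <-]; split; first by rewrite derivable_transport.
exact: derive_transport.
Qed.

End Transport.

Section DirectionalCalculus.
Context {R : realType} {V : normedModType R}.

(** The sign of [h] is free because difference quotients approach a point from
    both sides. *)
Lemma line_MVT (f : V -> R) (y w : V) (h : R) :
  (forall s : R, `|s| <= `|h| -> derivable f (s *: w + y) w) ->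
  exists2 s : R, `|s| <= `|h| & f (h *: w + y) - f y = h * 'D_w f (s *: w + y).
Proof.
move=> df.
pose g (s : R) := f (s *: w + y).
have dg s : `|s| <= `|h| -> is_derive (s : R) (1 : R) g ('D_w f (s *: w + y)).
  move=> sh; apply: (@is_derive_transport _ _ _ _ f g (s *: w + y) w).
    by move=> k; rewrite /g scaler1 scalerDl addrA.
  exact/derivableP/df.
have cg (i : interval R) : (forall s, s \in i -> `|s| <= `|h|) ->
    {within [set` i], continuous g}.
  move=> ih; apply: derivable_within_continuous => s si.
  by have [] := dg s (ih s si).
have g0 : g 0 = f y by rewrite /g scale0r add0r.
have [h0|h0|h0] := ltgtP h 0.
- have := @MVT R g (fun s => 'D_w f (s *: w + y)) h 0 h0.
  have bnd s : h <= s -> s <= 0 -> `|s| <= `|h|.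
    by move=> hs s0; rewrite (ltr0_norm h0) ler0_norm// lerN2.
  case.
  + by move=> s /[!in_itv]/= /andP[hs s0]; apply/dg/bnd; exact: ltW.
  + by apply: cg => s /[!in_itv]/= /andP[hs s0]; exact: bnd.
  + move=> s /[!in_itv]/= /andP[hs s0] gs; exists s; first by apply: bnd; exact: ltW.
    by rewrite -g0 -/(g h) -opprB gs sub0r mulrN opprK mulrC.
- have := @MVT R g (fun s => 'D_w f (s *: w + y)) 0 h h0.
  have bnd s : 0 <= s -> s <= h -> `|s| <= `|h|.
    by move=> s0 hs; rewrite !ger0_norm// ltW.
  case.
  + by move=> s /[!in_itv]/= /andP[hs s0]; apply/dg/bnd; exact: ltW.
  + by apply: cg => s /[!in_itv]/= /andP[hs s0]; exact: bnd.
  + move=> s /[!in_itv]/= /andP[hs s0] gs; exists s; first by apply: bnd; exact: ltW.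
    by rewrite -g0 -/(g h) gs subr0 mulrC.
- by exists 0; rewrite ?normr0// h0 scale0r add0r subrr mul0r.
Qed.

Lemma small_combination (v w : V) (r : R) : 0 < r ->
  exists2 d : R, 0 < d &
  forall h k : R, `|h| <= d -> `|k| <= d -> `|h *: v + k *: w| < r.
Proof.
move=> r0; have m0 : 0 < `|v| + `|w| + 1 by rewrite ltr_wpDl// addr_ge0.
exists (r / (`|v| + `|w| + 1)); first by rewrite divr_gt0.
move=> h k hd kd; rewrite (le_lt_trans (ler_normD _ _))// !normrZ.
rewrite (@le_lt_trans _ _ (r / (`|v| + `|w| + 1) * (`|v| + `|w|)))//.
  by rewrite mulrDr lerD// ler_wpM2r.
by rewrite mulrAC ltr_pdivrMr// ltr_pM2l// ltrDl.
Qed.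

(** The increment along [v + w] is an increment along [v] followed by one along
    [w]. By the mean value theorem the second is [h] times a value of ['D_w f]
    at a point tending to [x], so continuity of that one derivative suffices. *)
Lemma is_derive_dirD_real (f : V -> R) (x v w : V) :
  derivable f x v -> (\forall y \near x, derivable f y w) ->
  {for x, continuous ('D_w f)} ->
  is_derive x (v + w) f ('D_v f x + 'D_w f x).
Proof.
move=> dv dw cw.
suff cv : h^-1 *: ((f \o shift x) (h *: (v + w)) - f x) @[h --> 0^'] -->
    'D_v f x + 'D_w f x.
  by split; [apply/cvg_ex; exists ('D_v f x + 'D_w f x)|exact/cvg_lim].
rewrite (_ : (fun h : R => _) = (fun h => h^-1 *: ((f \o shift x) (h *: v) - f x)
     + h^-1 *: (f (h *: w + (h *: v + x)) - f (h *: v + x)))); last first.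
  apply/funext => h /=; rewrite -scalerDr [in RHS]addrC addrA subrK; congr (_ *: (f _ - _)).
  by rewrite scalerDr addrCA addrA.
apply: cvgD; first exact: dv.
apply/cvgrPdist_lt => e e0.
have /nbhs_ballP[r /= r0 rP] : \forall y \near x, derivable f y w /\
    `|'D_w f x - 'D_w f y| < e.
  near=> y; split; first by near: y.
  by near: y; move/cvgrPdist_lt : cw; exact.
have [d d0 dP] := small_combination v w r0.
near=> h.
have hd : `|h| <= d by near: h; apply: dnbhs0_le.
have h0 : h != 0 by near: h; exact: nbhs_dnbhs_neq.
have inb s : `|s| <= `|h| -> ball x r (s *: w + (h *: v + x)).
  move=> sh; rewrite -ball_normE /=.
  rewrite addrA [X in x - X]addrC opprD addNKr normrN addrC.
  by apply: dP => //; exact: le_trans hd.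
have [|s sh ->] := @line_MVT f (h *: v + x) w h.
  by move=> s sh; have [] := rP _ (inb _ sh).
by rewrite [_ *: _]mulKf//; have [] := rP _ (inb _ sh).
Unshelve. all: end_near. Qed.

(** The form in which the symmetry of second derivatives is obtained: two
    continuous functions that share a value, at possibly different points, in
    every neighbourhood of [x] agree at [x]. *)
Lemma continuous_coincide (A B : V -> R) (x : V) :
  {for x, continuous A} -> {for x, continuous B} ->
  (forall r, 0 < r -> exists2 y, ball x r y & exists2 z, ball x r z & B y = A z) ->
  A x = B x.
Proof.
move=> cA cB near_eq.
apply/eqP; rewrite -subr_eq0; apply/negPn/negP => ne.
pose e := `|A x - B x| / 2.
have e0 : 0 < e by rewrite divr_gt0// normr_gt0.
have /cvgrPdist_lt/(_ _ e0) near_A := cA.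
have /cvgrPdist_lt/(_ _ e0) near_B := cB.
have /nbhs_ballP[r /= r0 rP] : \forall y \near x,
    `|A x - A y| < e /\ `|B x - B y| < e.
  exact: filterI near_A near_B.
have [y yb [z zb yz]] := near_eq r r0.
have [_ h1] := rP _ yb.
have [h2 _] := rP _ zb.
have : `|A x - B x| < e + e.
  rewrite -(subrKA (A z)) (le_lt_trans (ler_normD _ _))//.
  by rewrite ltrD// -yz distrC.
by rewrite /e -splitr ltxx.
Qed.

(** The second difference of [f] over the parallelogram of sides [d a] and
    [d b] at [x] is symmetric in [a] and [b], and two applications of the mean
    value theorem make it [d ^ 2] times a value of either mixed derivative at a
    point of the parallelogram. *)
Lemma symmetric_mixed_derivative (f : V -> R) (x a b : V) :
  (\forall y \near x, [/\ derivable f y a, derivable f y b,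
     derivable ('D_b f) y a & derivable ('D_a f) y b]) ->
  {for x, continuous ('D_a ('D_b f))} -> {for x, continuous ('D_b ('D_a f))} ->
  'D_a ('D_b f) x = 'D_b ('D_a f) x.
Proof.
have key (g : V -> R) u w r d : 0 < r ->
    (forall y, ball x r y -> derivable g y u /\ derivable ('D_u g) y w) ->
    (forall h k : R, `|h| <= d -> `|k| <= d -> `|h *: u + k *: w| < r) -> 0 < d ->
    exists2 y, ball x r y &
      g (d *: u + (d *: w + x)) - g (d *: w + x) - (g (d *: u + x) - g x) =
      d * d * 'D_w ('D_u g) y.
  move=> r0 dg dP d0.
  have inb h k : `|h| <= d -> `|k| <= d -> ball x r (h *: u + (k *: w + x)).
    move=> hd kd; rewrite -ball_normE /= addrA [X in x - X]addrC opprD addNKr.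
    by rewrite normrN dP.
  have dd : `|d| <= d by rewrite gtr0_norm.
  pose G y := g (d *: w + y) - g y.
  have dG s : `|s| <= d -> is_derive (s *: u + x) u G
      ('D_u g (d *: w + (s *: u + x)) - 'D_u g (s *: u + x)).
    move=> sd; apply: is_deriveB; last first.
      by apply/derivableP; have := (dg _ (inb s 0 sd _)).1; rewrite scale0r add0r; apply; rewrite normr0 ltW.
    apply: (@is_derive_transport _ _ _ _ g _ (d *: w + (s *: u + x)) u).
      by move=> h /=; rewrite addrCA.
    apply/derivableP.
    by have := (dg _ (inb s d sd dd)).1; rewrite addrCA.
  have [|s sd GE] := @line_MVT G x u d.
    by move=> s; rewrite (gtr0_norm d0) => sd; have [] := dG s sd.
  rewrite (gtr0_norm d0) in sd.
  have [|k kd gE] := @line_MVT ('D_u g) (s *: u + x) w d.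
    move=> k; rewrite (gtr0_norm d0) => kd.
    by have := (dg _ (inb s k sd kd)).2; rewrite addrCA.
  rewrite (gtr0_norm d0) in kd.
  exists (k *: w + (s *: u + x)); first by rewrite addrCA; exact: inb.
  rewrite -mulrA -gE.
  have [_ <-] := dG s sd.
  rewrite -GE /G [d *: u + (d *: w + x)]addrCA.
  by move: (g _) (g (d *: u + x)) (g _) (g _) => *; ring.
move=> df ca cb; apply: (continuous_coincide ca cb) => r r0.
have /nbhs_ballP[r1 /= r10 r1P] := df.
have m0 : 0 < Num.min r r1 by rewrite lt_min r0.
have [d d0 dP] := small_combination a b m0.
have rP y : ball x (Num.min r r1) y -> [/\ derivable f y a, derivable f y b,
     derivable ('D_b f) y a & derivable ('D_a f) y b].
  by move=> yb; apply: r1P; apply: le_ball yb; rewrite ge_min lexx orbT.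
have [|//|y yb E1] := key f a b _ d m0 _ _ d0; first by move=> y /rP[].
have [|h k hd kd|z zb E2] := key f b a _ d m0 _ _ d0; first by move=> y' /rP[].
  by rewrite addrC dP.
have sub u : ball x (Num.min r r1) u -> ball x r u.
  by apply: le_ball; rewrite ge_min lexx.
exists y; [exact: sub|exists z; [exact: sub|]].
have : d * d * 'D_b ('D_a f) y = d * d * 'D_a ('D_b f) z.
  rewrite -E1 -E2 [d *: a + (d *: b + x)]addrCA.
  by move: (f _) (f (d *: b + x)) (f _) (f _) => *; ring.
by apply: mulfI; rewrite mulf_neq0// gt_eqF.
Qed.

End DirectionalCalculus.

(** * Smooth maps *)
Section Locality.
Context {R : realType} {V W : normedModType R}.
Implicit Types (f g : V -> W) (U : set V).

Lemma iter_derive_local U f g : open U -> (forall x, U x -> f x = g x) ->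
  forall vs x, U x -> iter_derive vs f x = iter_derive vs g x.
Proof.
move=> oU fg; elim=> [|v vs IH] x Ux /=; first exact: fg.
apply: near_eq_derive.
by have := open_nbhs_nbhs (conj oU Ux); apply: filterS.
Qed.

Lemma smooth_on_open_local U f g : open U -> (forall x, U x -> f x = g x) ->
  smooth_on_open U f -> smooth_on_open U g.
Proof.
move=> oU fg sf vs x Ux; have [df cf] := sf vs x Ux.
have near_fg : \forall y \near x, iter_derive vs f y = iter_derive vs g y.
  have := open_nbhs_nbhs (conj oU Ux); apply: filterS => y.
  exact: iter_derive_local.
split=> [v|]; first by apply: (near_eq_derivable near_fg).
rewrite /prop_for /continuous_at -(nbhs_singleton near_fg).
by apply: cvg_trans cf; exact: near_eq_cvg.
Qed.

(** Near a point of an open set a local extension is the map itself. *)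
Lemma smooth_on_openP U f : open U -> smooth_on U f -> smooth_on_open U f.
Proof.
move=> oU sf vs x Ux; have [U' [g [oU' U'x sg gf]]] := sf x Ux.
have sg' : smooth_on_open (U `&` U') g by move=> ws y [_ U'y]; exact: sg.
apply: (smooth_on_open_local _ _ sg') => //; first exact: openI.
by move=> y []; exact: gf.
Qed.

Lemma smooth_on_openS U U' f : U `<=` U' -> smooth_on_open U' f -> smooth_on_open U f.
Proof. by move=> UU' sf vs x /UU'; exact: sf. Qed.

Lemma iter_derive_rcons vs v f : iter_derive (rcons vs v) f = iter_derive vs ('D_v f).
Proof. by elim: vs => //= w vs ->. Qed.

Lemma smooth_on_open_derive U f v : smooth_on_open U f -> smooth_on_open U ('D_v f).
Proof. by move=> sf vs x Ux; have := sf (rcons vs v) x Ux; rewrite iter_derive_rcons. Qed.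

Lemma smooth_continuous U f x : smooth_on_open U f -> U x -> {for x, continuous f}.
Proof. by move=> sf Ux; have [] := sf [::] x Ux. Qed.

Lemma smooth_derivable U f x v : smooth_on_open U f -> U x -> derivable f x v.
Proof. by move=> sf Ux; have [] := sf [::] x Ux. Qed.

End Locality.

(** An affine substitution with linear part [L] maps lines to lines, so it turns
    iterated derivatives along [vs] into iterated derivatives along the images of
    [vs]. This covers translations and the slices at a fixed time. *)
Section AffineSubstitution.
Context {R : realType} {V V' W : normedModType R}.
Variables (s : V' -> V) (L : V' -> V).
Hypothesis affine : forall h v x, s (h *: v + x) = h *: L v + s x.

Lemma iter_derive_affine vs (f : V -> W) :
  iter_derive vs (f \o s) = iter_derive (map L vs) f \o s.
Proof.
elim: vs => //= v vs ->; apply/funext => x.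
by apply: derive_transport => h /=; rewrite affine.
Qed.

Lemma smooth_on_open_affine U (f : V -> W) : continuous s ->
  smooth_on_open U f -> smooth_on_open (s @^-1` U) (f \o s).
Proof.
move=> cs sf vs x Ux; rewrite iter_derive_affine.
have [df cf] := sf (map L vs) (s x) Ux; split=> [v|].
  rewrite (@derivable_transport _ _ _ _ (iter_derive (map L vs) f) _ (s x) (L v))//.
  by move=> h /=; rewrite affine.
by apply: continuous_comp => //; exact: cs.
Qed.

End AffineSubstitution.

Section Components.
Context {R : realType} {V : normedModType R} {m n : nat}.
Implicit Types (f : V -> 'M[R]_(m, n)) (U : set V).

Lemma derivable_coord f x v i j : derivable f x v -> derivable (fun y => f y i j) x v.
Proof. by move/derivable_mxP. Qed.

Lemma derive_coord f x v i j : derivable f x v ->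
  'D_v (fun y => f y i j) x = 'D_v f x i j.
Proof. by move=> df; rewrite derive_mx// mxE. Qed.

Lemma continuous_coord f x i j :
  {for x, continuous f} -> {for x, continuous (fun y => f y i j)}.
Proof.
move=> cf; apply: (cvg_comp f (fun M : 'M[R]_(m, n) => M i j) cf).
exact: coord_continuous.
Qed.

Lemma iter_derive_coord U f vs x i j : open U -> smooth_on_open U f -> U x ->
  iter_derive vs (fun y => f y i j) x = iter_derive vs f x i j.
Proof.
move=> oU sf; elim: vs x => //= v vs IH x Ux.
rewrite -derive_coord; last by have [] := sf vs x Ux.
apply: near_eq_derive.
by have := open_nbhs_nbhs (conj oU Ux); apply: filterS.
Qed.

Lemma smooth_coord U f i j : open U -> smooth_on_open U f ->
  smooth_on_open U (fun y => f y i j).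
Proof.
move=> oU sf vs x Ux; have [df cf] := sf vs x Ux.
have E : \forall y \near x,
    iter_derive vs f y i j = iter_derive vs (fun y => f y i j) y.
  have := open_nbhs_nbhs (conj oU Ux); apply: filterS => y Uy.
  by rewrite (iter_derive_coord _ _ _ oU).
split=> [v|].
  by apply: (near_eq_derivable E); exact: derivable_coord.
rewrite /prop_for /continuous_at -(nbhs_singleton E).
by apply: cvg_trans (continuous_coord cf); exact: near_eq_cvg.
Qed.

Lemma continuous_mx f x :
  (forall i j, {for x, continuous (fun y => f y i j)}) -> {for x, continuous f}.
Proof.
move=> cf; apply/cvgrPdist_lt => e e0.
near=> y.
rewrite [ltLHS]/Num.Def.normr/= mx_normrE.
apply: bigmax_lt => //= -[i j] _; rewrite !mxE/=.
move: i j; near: y; apply: filter_forall => i; apply: filter_forall => j.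
by move/cvgrPdist_lt : (cf i j); exact.
Unshelve. all: end_near. Qed.

(** The derivatives of a matrix-valued map are computed entrywise, but only
    where the map is differentiable; hence the induction on the order, which
    yields differentiability and the formula together. *)
Lemma smooth_mx U f : open U ->
  (forall i j, smooth_on_open U (fun y => f y i j)) -> smooth_on_open U f.
Proof.
move=> oU sf.
have E vs x : U x ->
    iter_derive vs f x = \matrix_(i, j) iter_derive vs (fun y => f y i j) x.
  elim: vs x => /= [|v vs IH] x Ux; first by apply/matrixP => i j; rewrite mxE.
  have near_E : \forall y \near x, iter_derive vs f y =
      \matrix_(i, j) iter_derive vs (fun y => f y i j) y.
    by have := open_nbhs_nbhs (conj oU Ux); apply: filterS => y; exact: IH.
  rewrite (near_eq_derive v near_E) derive_mx.
    apply/matrixP => i j; rewrite !mxE; congr ('D_v _ x).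
    by apply/funext => y; rewrite mxE.
  apply/derivable_mxP => i j.
  rewrite (_ : (fun y => _) = iter_derive vs (fun y => f y i j)); last first.
    by apply/funext => y; rewrite mxE.
  by have [] := sf i j vs x Ux.
move=> vs x Ux.
have near_E : \forall y \near x, (\matrix_(i, j) iter_derive vs (fun y => f y i j) y) =
    iter_derive vs f y.
  by have := open_nbhs_nbhs (conj oU Ux); apply: filterS => y /E.
split=> [v|].
  apply: (near_eq_derivable near_E); apply/derivable_mxP => i j.
  rewrite (_ : (fun y => _) = iter_derive vs (fun y => f y i j)); last first.
    by apply/funext => y; rewrite mxE.
  by have [] := sf i j vs x Ux.
rewrite /prop_for /continuous_at -(nbhs_singleton near_E).
apply: (cvg_trans (near_eq_cvg near_E)); apply: continuous_mx => i j.
rewrite (_ : (fun y => _) = iter_derive vs (fun y => f y i j)); last first.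
  by apply/funext => y; rewrite mxE.
by have [] := sf i j vs x Ux.
Qed.

End Components.

(** A polynomial change of the time variable preserves smoothness. Two instances
    are used: [t + e], which moves the origin of time, and [e ^ 2], which extends
    a map defined for nonnegative times to all times. *)
Section TimeChange.
Context {R : realType} {V : normedModType R} (alpha : {poly R}).

Definition time_change (z : R * V) : R * V := (alpha.[z.1], z.2).

Let continuous_time (c : {poly R}) (z : R * V) :
  {for z, continuous (fun z : R * V => c.[z.1])}.
Proof.
apply: (@continuous_comp _ _ _ (@fst R V) (horner c)); first exact: cvg_fst.
exact: continuous_horner.
Qed.

Lemma continuous_time_change : continuous time_change.
Proof.
move=> z.
apply: (@cvg_pair _ _ _ (nbhs z) (nbhs alpha.[z.1]) (nbhs z.2) _ _ _
  (fun z => alpha.[z.1]) snd); last exact: cvg_snd.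
exact: continuous_time.
Qed.

Let is_derive_time (c : {poly R}) (z w : R * V) :
  is_derive z w (fun z => c.[z.1]) (w.1 * c^`().[z.1]).
Proof.
pose l (h : R) := h * w.1 + z.1.
apply: (@is_derive_transport _ R _ _ (horner c \o l) _ 0 1).
  by move=> h; rewrite /l /= scaler1 addr0.
rewrite mulrC; apply: is_derive1_comp.
  by rewrite /l mul0r add0r; exact: is_derive_poly.
rewrite (_ : l = (id : R -> R) * cst w.1 + cst z.1)//; apply: is_derive_eq.
by rewrite scaler0 add0r addr0 scaler1.
Qed.

(** The chain rule is needed in the time direction only, where it is the
    one-variable one; the space direction is affine, and the two directions are
    put together by additivity. *)
Lemma is_derive_time_change (U : set (R * V)) (f : R * V -> R) (z w : R * V) :
  open U -> smooth_on_open U f -> U (time_change z) ->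
  is_derive z w (f \o time_change)
    (w.1 * alpha^`().[z.1] * 'D_(1, 0) f (time_change z)
     + 'D_(0, w.2) f (time_change z)).
Proof.
move=> oU sf Uz.
have tr y v : 'D_(0, v) (f \o time_change) y = ('D_(0, v) f \o time_change) y.
  apply: derive_transport => h; rewrite /time_change /=.
  by rewrite scaler0 add0r; congr (f (_, _)); rewrite /= scaler0 add0r.
have dtr y v : U (time_change y) -> derivable (f \o time_change) y (0, v).
  move=> Uy; rewrite (@derivable_transport _ _ _ _ f _ (time_change y) (0, v)).
    exact: smooth_derivable Uy.
  move=> h; rewrite /time_change /=.
  by rewrite scaler0 add0r; congr (f (_, _)); rewrite /= scaler0 add0r.
have dt : is_derive z (w.1, 0) (f \o time_change)
    (w.1 * alpha^`().[z.1] * 'D_(1, 0) f (time_change z)).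
  pose g (s : R) := f (s, z.2).
  have dg : is_derive alpha.[z.1] (1 : R) g ('D_(1, 0) f (time_change z)).
    apply: (@is_derive_transport _ _ _ _ f _ (time_change z) (1, 0)).
      by move=> h; rewrite /g /time_change; congr (f (_, _)); rewrite /= scaler0 add0r.
    by apply/derivableP; exact: smooth_derivable Uz.
  pose l (h : R) := alpha.[h * w.1 + z.1].
  have dl : is_derive (0 : R) (1 : R) l (w.1 * alpha^`().[z.1]).
    apply: (@is_derive_transport _ _ _ _ (fun y : R * V => alpha.[y.1]) _ z w).
      by move=> h; rewrite /l /= scaler1 addr0.
    exact: is_derive_time.
  have l0 : l 0 = alpha.[z.1] by rewrite /l mul0r add0r.
  apply: (@is_derive_transport _ R _ _ (g \o l) _ 0 1).
    move=> h; rewrite /g /l /time_change /= scaler1 addr0.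
    by congr (f (_, _)); rewrite scaler0 add0r.
  by rewrite mulrC; apply: is_derive1_comp => //; rewrite l0.
have [d1 e1] := dt.
have wE : w = (w.1, 0) + (0, w.2) by case: w {dt d1 e1} => a b; congr (_, _); rewrite /= ?addr0 ?add0r.
have e2 : 'D_(0, w.2) (f \o time_change) z = 'D_(0, w.2) f (time_change z) := tr z w.2.
rewrite [X in is_derive _ X]wE -e1 -e2.
have nearU : \forall y \near z, U (time_change y).
  by apply: continuous_time_change; exact: open_nbhs_nbhs.
apply: is_derive_dirD_real => //.
  by apply: filterS nearU => y; exact: dtr.
rewrite (_ : 'D_ _ _ = 'D_(0, w.2) f \o time_change); last first.
  by apply/funext => y; exact: tr.
apply: continuous_comp; first exact: continuous_time_change.
exact: (smooth_continuous (smooth_on_open_derive _ sf)).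
Qed.

(** An iterated derivative of [f \o time_change] is a finite sum of terms
    [c.[e] * g (alpha.[e], u)] with [c] a polynomial and [g] an iterated
    derivative of [f]. A term is encoded by [c] and the list of directions of
    [g]; [derive_terms] lists the terms of its derivative. *)
Let term (f : R * V -> R) (t : {poly R} * seq (R * V)) (z : R * V) : R :=
  t.1.[z.1] * (iter_derive t.2 f \o time_change) z.

Let expansion (f : R * V -> R) (l : seq ({poly R} * seq (R * V))) (z : R * V) : R :=
  \sum_(t <- l) term f t z.

Let derive_terms (w : R * V) (t : {poly R} * seq (R * V)) :=
  [:: (w.1 *: t.1^`(), t.2); (w.1 *: (t.1 * alpha^`()), (1, 0) :: t.2);
      (t.1, (0, w.2) :: t.2)].

Let is_derive_expansion (U : set (R * V)) f w l z :
  open U -> smooth_on_open U f -> U (time_change z) ->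
  is_derive z w (expansion f l) (expansion f (flatten (map (derive_terms w) l)) z).
Proof.
move=> oU sf Uz; elim: l => [|t l IH].
  rewrite /= (_ : expansion f [::] = cst 0); first exact: is_derive_cst.
  by apply/funext => y; rewrite /expansion big_nil.
rewrite (_ : expansion f (t :: l) = term f t + expansion f l); last first.
  by apply/funext => y; rewrite /expansion big_cons.
rewrite [X in is_derive _ _ _ X](_ : _ =
    expansion f (derive_terms w t) z + expansion f (flatten (map (derive_terms w) l)) z); last first.
  by rewrite /expansion /= -big_cat.
apply: is_deriveD.
have st : smooth_on_open U (iter_derive t.2 f).
  by elim: t.2 => //= v vs; exact: smooth_on_open_derive.
rewrite (_ : term f t = (fun z => t.1.[z.1]) * (iter_derive t.2 f \o time_change))//.
have d1 := is_derive_time t.1 z w.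
have d2 := is_derive_time_change w oU st Uz.
apply: is_derive_eq.
rewrite /expansion !big_cons big_nil /term /= !hornerE /GRing.scale /=.
ring.
Qed.

Let continuous_expansion (U : set (R * V)) f l z :
  open U -> smooth_on_open U f -> U (time_change z) ->
  {for z, continuous (expansion f l)}.
Proof.
move=> oU sf Uz; elim: l => [|t l IH].
  rewrite (_ : expansion f [::] = cst 0); first exact: cst_continuous.
  by apply/funext => y; rewrite /expansion big_nil.
rewrite (_ : expansion f (t :: l) = term f t \+ expansion f l); last first.
  by apply/funext => y; rewrite /expansion big_cons.
apply: continuousD => //; apply: continuousM.
  exact: continuous_time.
apply: continuous_comp; first exact: continuous_time_change.
by have [] := sf t.2 _ Uz.
Qed.

Lemma smooth_time_change_real (U : set (R * V)) (f : R * V -> R) :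
  open U -> smooth_on_open U f ->
  smooth_on_open (time_change @^-1` U) (f \o time_change).
Proof.
move=> oU sf.
have oU' : open (time_change @^-1` U).
  by apply: open_comp => // z _; exact: continuous_time_change.
have E vs : exists l, forall z, U (time_change z) ->
    iter_derive vs (f \o time_change) z = expansion f l z.
  elim: vs => [|v vs [l IH]].
    exists [:: (1, [::])] => z _.
    by rewrite /expansion big_seq1 /term /= hornerC mul1r.
  exists (flatten (map (derive_terms v) l)) => z Uz /=.
  have [_ <-] := is_derive_expansion v l oU sf Uz.
  apply: near_eq_derive.
  by have := open_nbhs_nbhs (conj oU' Uz); apply: filterS.
move=> vs z Uz; have [l El] := E vs.
have near_E : \forall y \near z,
    expansion f l y = iter_derive vs (f \o time_change) y.
  by have := open_nbhs_nbhs (conj oU' Uz); apply: filterS => y /El.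
split=> [v|].
  apply: (near_eq_derivable near_E).
  by have [] := is_derive_expansion v l oU sf Uz.
rewrite /prop_for /continuous_at -(nbhs_singleton near_E).
apply: (cvg_trans (near_eq_cvg near_E)).
exact: continuous_expansion Uz.
Qed.

Lemma smooth_on_time_change {n : nat} (A B : set (R * V)) (f : R * V -> 'rV[R]_n) :
  (forall z, B z -> A (time_change z)) ->
  smooth_on A f -> smooth_on B (f \o time_change).
Proof.
move=> AB sf z Bz; have [U [g [oU Uz sg gf]]] := sf _ (AB _ Bz).
have oU' : open (time_change @^-1` U).
  by apply: open_comp => // y _; exact: continuous_time_change.
exists (time_change @^-1` U), (g \o time_change); split => //.
- apply: smooth_mx => // i j.
  exact: (smooth_time_change_real oU (smooth_coord i j oU sg)).
- by move=> y By Uy /=; rewrite gf//; exact: AB.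
Qed.

End TimeChange.

(** * Gram matrix and mean curvature of a parametrised surface *)
Section Dot.
Context {R : realType}.
Implicit Types (a b c : 'rV[R]_4) (k : R).

Lemma dotC a b : dot a b = dot b a.
Proof. by apply: eq_bigr => i _; rewrite mulrC. Qed.

Lemma dotDl a b c : dot (a + b) c = dot a c + dot b c.
Proof. by rewrite -big_split; apply: eq_bigr => i _; rewrite mxE mulrDl. Qed.

Lemma dotZl k a b : dot (k *: a) b = k * dot a b.
Proof. by rewrite mulr_sumr; apply: eq_bigr => i _; rewrite mxE mulrA. Qed.

Lemma dotNl a b : dot (- a) b = - dot a b.
Proof. by rewrite -scaleN1r dotZl mulN1r. Qed.

Lemma dot0l b : dot 0 b = 0.
Proof. by rewrite -(scale0r 0) dotZl mul0r. Qed.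

Lemma dotDr a b c : dot a (b + c) = dot a b + dot a c.
Proof. by rewrite ![dot a _]dotC dotDl. Qed.

Lemma dotZr k a b : dot a (k *: b) = k * dot a b.
Proof. by rewrite ![dot a _]dotC dotZl. Qed.

Lemma dotNr a b : dot a (- b) = - dot a b.
Proof. by rewrite ![dot a _]dotC dotNl. Qed.

Lemma dot0r a : dot a 0 = 0.
Proof. by rewrite dotC dot0l. Qed.

Lemma dot_sumr a (I : Type) (r : seq I) (f : I -> 'rV[R]_4) :
  dot a (\sum_(i <- r) f i) = \sum_(i <- r) dot a (f i).
Proof. exact: (big_morph _ (dotDr a) (dot0r a)). Qed.

Lemma dot_ge0 a : 0 <= dot a a.
Proof. by apply: sumr_ge0 => i _; rewrite -expr2 sqr_ge0. Qed.

Lemma dot_gt0 a : a != 0 -> 0 < dot a a.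
Proof.
move=> a0; rewrite lt_neqAle dot_ge0 andbT eq_sym; apply: contra a0 => /eqP aa.
apply/eqP/rowP => i; rewrite mxE.
have /psumr_eq0P := aa => /(_ (fun i _ => sqr_ge0 (a 0 i)))/(_ i isT)/eqP.
by rewrite -expr2 sqrf_eq0 => /eqP.
Qed.

(** Expand the squared length of [a + b / k] and of [a - b / k]. *)
Lemma dot_amgm k a b : 0 < k -> `|dot a b| <= (k * dot a a + k^-1 * dot b b) / 2.
Proof.
move=> k0.
have sq s : 0 <= k * dot a a + s * 2 * dot a b + s ^+ 2 * (k^-1 * dot b b).
  have := mulr_ge0 (ltW k0) (dot_ge0 (a + (s * k^-1) *: b)).
  rewrite dotDl !dotDr !dotZl !dotZr [dot b a]dotC.
  by congr (_ <= _); field; rewrite gt_eqF.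
have := sq 1; have := sq (-1); rewrite ler_norml => h1 h2.
by apply/andP; split; lra.
Qed.

Context {V : normedModType R}.
Implicit Types (f g : V -> 'rV[R]_4) (x v : V).

Lemma is_derive_dot f g x v : derivable f x v -> derivable g x v ->
  is_derive x v (fun y => dot (f y) (g y)) (dot ('D_v f x) (g x) + dot (f x) ('D_v g x)).
Proof.
move=> df dg.
rewrite (_ : (fun y => dot (f y) (g y)) = \sum_k ((fun y => f y 0 k) * (fun y => g y 0 k))); last first.
  by apply/funext => y; rewrite fct_sumE.
rewrite -big_split.
apply: is_derive_sum => k.
have d1 : is_derive x v (fun y => f y 0 k) ('D_v f x 0 k).
  by split; [exact: derivable_coord|exact: derive_coord].
have d2 : is_derive x v (fun y => g y 0 k) ('D_v g x 0 k).
  by split; [exact: derivable_coord|exact: derive_coord].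
apply: is_derive_eq; rewrite /GRing.scale /= addrC mulrC; congr (_ + _).
by rewrite mulrC.
Qed.

Lemma continuous_dot f g x : {for x, continuous f} -> {for x, continuous g} ->
  {for x, continuous (fun y => dot (f y) (g y))}.
Proof.
move=> cf cg.
rewrite (_ : (fun y => dot (f y) (g y)) = \sum_k ((fun y => f y 0 k) * (fun y => g y 0 k))); last first.
  by apply/funext => y; rewrite fct_sumE.
apply: (@big_ind _ (fun h : V -> R => {for x, continuous h})).
- exact: cst_continuous.
- by move=> h1 h2 c1 c2; exact: continuousD.
- by move=> k _; apply: continuousM; exact: continuous_coord.
Qed.

End Dot.

Section LinearDirection.
Context {R : realType} {V : normedModType R}.

Lemma is_derive_dirZ (f : V -> R) (x v : V) (a : R) : derivable f x v ->
  is_derive x (a *: v) f (a * 'D_v f x).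
Proof.
move=> df.
pose g (s : R) := f (s *: v + x).
have dg : is_derive (0 : R) (1 : R) g ('D_v f x).
  apply: (@is_derive_transport _ _ _ _ f _ x v); last exact/derivableP.
  by move=> h; rewrite /g addr0 scaler1.
pose l (h : R) := h * a.
have dl : is_derive (0 : R) (1 : R) l a.
  have -> : l = (id : R -> R) * cst a by [].
  apply: is_derive_eq.
  by rewrite scaler0 add0r scaler1.
apply: (@is_derive_transport _ R _ _ (g \o l) _ 0 1).
  by move=> h; rewrite /g /l /= addr0 scaler1 scalerA.
rewrite mulrC; apply: is_derive1_comp.
rewrite /l mul0r; exact: dg.
Qed.

End LinearDirection.

(** Linearity in the direction, which makes the two partial derivatives of an
    immersion linearly independent. *)
Lemma derive_plane_real {R : realType} (f : R * R -> R) (u v : R * R) :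
  smooth_on_open setT f -> 'D_v f u = v.1 * 'D_(1, 0) f u + v.2 * 'D_(0, 1) f u.
Proof.
move=> sf.
have d w y : derivable f y w by exact: smooth_derivable sf _.
have E w : 'D_(0, w) f = w \*o 'D_(0, 1) f.
  apply/funext => y; have [_ e] := is_derive_dirZ w (d (0, 1) y).
  rewrite [RHS]/= -e; congr ('D_ _ _ y).
  by congr (_, _); rewrite /= ?scaler0 ?scaler1.
have [_ e1] := is_derive_dirZ v.1 (d (1, 0) u).
have vE : v = v.1 *: (1, 0) + (0, v.2).
  by case: v {e1} => a b; congr (_, _); rewrite /= ?scaler0 ?scaler1 ?addr0 ?add0r.
rewrite {1}vE -e1 -[v.2 * _]/((v.2 \*o 'D_(0, 1) f) u) -E.
have nd : \forall y \near u, derivable f y (0, v.2).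
  by near=> y; exact: d.
have cw : {for u, continuous ('D_(0, v.2) f)}.
  exact: (smooth_continuous (smooth_on_open_derive _ sf)).
have [_ e2] := is_derive_dirD_real (d (v.1 *: (1, 0)) u) nd cw.
exact: e2.
Unshelve. all: end_near. Qed.

Lemma derive_plane {R : realType} {n : nat} (X : R * R -> 'rV[R]_n) (u v : R * R) :
  smooth_on_open setT X ->
  'D_v X u = v.1 *: 'D_(1, 0) X u + v.2 *: 'D_(0, 1) X u.
Proof.
move=> sX.
have comb (a b : R) (A B : 'rV[R]_n) i j : (a *: A + b *: B) i j = a * A i j + b * B i j.
  by rewrite !mxE.
apply/matrixP => i j; rewrite comb.
have d w : derivable X u w by exact: smooth_derivable sX _.
have := derive_plane_real u v (smooth_coord i j openT sX).
by rewrite !derive_coord; try exact: d.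
Qed.

Section SurfaceAlgebra.
Context {R : realType}.
Implicit Types (X : R * R -> 'rV[R]_4) (u : R * R).

Lemma sum_ord2 (T : nmodType) (f : 'I_2 -> T) : \sum_i f i = f 0 + f 1.
Proof.
rewrite !big_ord_recl big_ord0 addr0; congr (f _ + f _); exact/val_inj.
Qed.

Lemma ord2_ind (P : 'I_2 -> Prop) : P 0 -> P 1 -> forall i, P i.
Proof.
by move=> P0 P1 [[|[|//]] hi]; [move: P0|move: P1]; congr P; exact/val_inj.
Qed.

Lemma det2 (A : 'M[R]_2) : \det A = A 0 0 * A 1 1 - A 0 1 * A 1 0.
Proof.
rewrite (expand_det_row _ 0) sum_ord2 /cofactor !det_mx11 !mxE /=.
have -> : lift (0 : 'I_2) 0 = 1 by exact/val_inj.
have -> : lift (1 : 'I_2) 0 = 0 by exact/val_inj.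
by rewrite !addn0 !add0n expr0 expr1 mul1r mulN1r mulrN.
Qed.

Lemma invmx2 (A : 'M[R]_2) : \det A != 0 ->
  [/\ invmx A 0 0 = (\det A)^-1 * A 1 1, invmx A 0 1 = (\det A)^-1 * - A 0 1,
      invmx A 1 0 = (\det A)^-1 * - A 1 0 & invmx A 1 1 = (\det A)^-1 * A 0 0].
Proof.
move=> D0.
pose B : 'M[R]_2 := (\det A)^-1 *:
  \matrix_(i, j) if i == j then A (1 - i) (1 - j) else - A i j.
have AB : A *m B = 1%:M.
  apply/matrixP => i j; rewrite mxE sum_ord2 !mxE det2.
  move: D0; rewrite det2.
  elim/ord2_ind: i; elim/ord2_ind: j => /=; rewrite ?subr0 ?subrr;
    move: (A 0 0) (A 0 1) (A 1 0) (A 1 1) => a b c d D0; by field.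
have [um _] := mulmx1_unit AB.
have -> : invmx A = B by rewrite -[RHS]mul1mx -(mulVmx um) -mulmxA AB mulmx1.
by split; rewrite !mxE /= ?subr0 ?subrr.
Qed.

(** The contraction of [b] with the inverse of a 2 x 2 matrix [a] of determinant
    [k^-1], written with the entries of [a]. *)
Lemma contract2 (k : R) (a b c : 'I_2 -> 'I_2 -> R) :
  [/\ c 0 0 = k * a 1 1, c 0 1 = k * - a 0 1, c 1 0 = k * - a 1 0 & c 1 1 = k * a 0 0] ->
  \sum_i \sum_j c i j * b i j =
  k * (a 1 1 * b 0 0 + a 0 0 * b 1 1 - a 0 1 * b 0 1 - a 1 0 * b 1 0).
Proof. by move=> [e00 e01 e10 e11]; rewrite !sum_ord2 e00 e01 e10 e11; ring. Qed.

(** The second vector is [dot a a] times the part of [b] orthogonal to [a], and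
    its squared length is [dot a a] times the Gram determinant. *)
Lemma gram_pair_gt0 (a b : 'rV[R]_4) : a != 0 -> dot a a *: b - dot a b *: a != 0 ->
  0 < dot a a * dot b b - dot a b * dot b a.
Proof.
move=> /dot_gt0 a0 /dot_gt0; rewrite dotDl !dotDr !dotNl !dotNr !dotZl !dotZr.
rewrite [dot b a]dotC; move: (dot a a) (dot a b) (dot b b) a0 => E F G E0.
by move=> h; rewrite -(pmulr_rgt0 _ E0); apply: etrans h; congr (_ < _); ring.
Qed.

Definition gram X u : R := \det (metric X u).

Lemma metricE X u i j : metric X u i j = dot (partial i X u) (partial j X u).
Proof. exact: mxE. Qed.

Lemma gramE X u : gram X u =
  dot (partial 0 X u) (partial 0 X u) * dot (partial 1 X u) (partial 1 X u)
  - dot (partial 0 X u) (partial 1 X u) * dot (partial 1 X u) (partial 0 X u).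
Proof. by rewrite /gram det2 !metricE. Qed.

Lemma cometricE X u : 0 < gram X u ->
  let a i j := dot (partial i X u) (partial j X u) in
  [/\ cometric X u 0 0 = (gram X u)^-1 * a 1 1, cometric X u 0 1 = (gram X u)^-1 * - a 0 1,
      cometric X u 1 0 = (gram X u)^-1 * - a 1 0 & cometric X u 1 1 = (gram X u)^-1 * a 0 0].
Proof.
move=> D0 a; have [|e1 e2 e3 e4] := @invmx2 (metric X u); first by rewrite gt_eqF.
split; [apply: etrans e1 _|apply: etrans e2 _|apply: etrans e3 _|apply: etrans e4 _];
  rewrite metricE; reflexivity.
Qed.

Lemma gram_gt0 X u : smooth_on_open setT X ->
  (forall v, 'D_v X u = 0 -> v = 0) -> 0 < gram X u.
Proof.
move=> sX inj; rewrite gramE; apply: gram_pair_gt0.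
  apply/eqP => a0; have /eqP := congr1 fst (inj (1, 0) a0).
  by rewrite oner_eq0.
apply/eqP => w0.
have h : 'D_(- dot (partial 0 X u) (partial 1 X u),
             dot (partial 0 X u) (partial 0 X u)) X u = 0.
  by rewrite derive_plane//= addrC scaleNr.
have /eqP := congr1 snd (inj _ h).
rewrite gt_eqF//; apply: dot_gt0.
apply/eqP => a0; have /eqP := congr1 fst (inj (1, 0) a0).
by rewrite oner_eq0.
Qed.

Lemma dot_normal_part X u n w : dot n (X u) = 0 ->
  (forall i, dot n (partial i X u) = 0) -> dot n (normal_part X u w) = dot n w.
Proof.
move=> n0 nt; rewrite /normal_part dotDr dotNr dotDr dotNr dotZr n0 mulr0 subr0.
rewrite dot_sumr big1 ?subr0// => i _; rewrite dot_sumr big1// => j _.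
by rewrite dotZr nt mulr0.
Qed.

(** Pairing with a normal vector [n] removes every tangential and radial
    correction in [normal_part], so only the trace of [dot n (d_i d_j X)] with
    respect to the metric is left. *)
Lemma dot_mean_curvature X u n : 0 < gram X u -> dot n (X u) = 0 ->
  (forall i, dot n (partial i X u) = 0) ->
  let a i j := dot (partial i X u) (partial j X u) in
  let b i j := dot n (partial i (partial j X) u) in
  dot n (mean_curvature X u) = (gram X u)^-1 *
    (a 1 1 * b 0 0 + a 0 0 * b 1 1 - a 0 1 * b 0 1 - a 1 0 * b 1 0).
Proof.
move=> D0 n0 nt a b.
have -> : dot n (mean_curvature X u) = \sum_i \sum_j cometric X u i j * b i j.
  rewrite /mean_curvature dot_sumr; apply: eq_bigr => i _.
  rewrite dot_sumr; apply: eq_bigr => j _.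
  by rewrite dotZr dot_normal_part.
exact: (contract2 b (cometricE D0)).
Qed.

End SurfaceAlgebra.

(** * First variation of the area density *)
Section SmoothMatrixFields.
Context {R : realType} {V : normedModType R} {m n : nat}.

Lemma smooth_derive_comm (U : set V) (X : V -> 'M[R]_(m, n)) (x a b : V) :
  open U -> smooth_on_open U X -> U x -> 'D_a ('D_b X) x = 'D_b ('D_a X) x.
Proof.
move=> oU sX Ux; apply/matrixP => i j.
have E c d : 'D_c ('D_d (fun y => X y i j)) x = 'D_c ('D_d X) x i j.
  exact: (iter_derive_coord [:: c; d] i j oU sX Ux).
apply: etrans (esym (E a b)) _; apply: etrans (E b a).
have sXij := smooth_coord i j oU sX.
have sD c := smooth_on_open_derive c sXij.
apply: symmetric_mixed_derivative.
- have := open_nbhs_nbhs (conj oU Ux); apply: filterS => y Uy.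
  by split; [exact: smooth_derivable sXij Uy|exact: smooth_derivable sXij Uy|
             exact: smooth_derivable (sD _) Uy|exact: smooth_derivable (sD _) Uy].
- exact: smooth_continuous (smooth_on_open_derive a (sD b)) Ux.
- exact: smooth_continuous (smooth_on_open_derive b (sD a)) Ux.
Qed.

End SmoothMatrixFields.

Section CurvatureInvariance.
Context {R : realType}.
Implicit Types (X : R * R -> 'rV[R]_4) (u : R * R).

Lemma partial_shift X w i : partial i (X \o shift w) = partial i X \o shift w.
Proof.
apply: (@iter_derive_affine _ _ _ _ (shift w) id _ [:: _] X) => h v x /=.
by rewrite addrA.
Qed.

Lemma mean_curvature_local X u u' : X u = X u' ->
  (forall i, partial i X u = partial i X u') ->
  (forall i j, partial i (partial j X) u = partial i (partial j X) u') ->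
  mean_curvature X u = mean_curvature X u'.
Proof.
move=> e0 e1 e2.
have em : metric X u = metric X u' by apply/matrixP => i j; rewrite !metricE !e1.
rewrite /mean_curvature /second_ff /normal_part /cometric em e0.
do 2 (apply: eq_bigr => ? _); rewrite e2; congr (_ *: (_ - _)).
by do 2 (apply: eq_bigr => ? _); rewrite !e1.
Qed.

(** The lift of an immersion of the torus is periodic, so its mean curvature
    does not depend on the preimage at which it is computed. *)
Lemma mean_curvature_periodic X w u : (forall v, X (v + w) = X v) ->
  mean_curvature X (u + w) = mean_curvature X u.
Proof.
move=> per.
have e0 : X \o shift w = X by apply/funext => v; exact: per.
have e1 i : partial i X \o shift w = partial i X by rewrite -partial_shift e0.
apply: mean_curvature_local => [|i|i j]; first exact: per.
  by rewrite -[RHS](congr1 (fun f : R * R -> 'rV[R]_4 => f u) (e1 i)).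
rewrite -[in RHS](e1 j) partial_shift.
by [].
Qed.

End CurvatureInvariance.

Section PointwiseContinuity.
Context {R : realType} {T : topologicalType}.

Lemma continuous_addr (f g : T -> R) (x : T) :
  {for x, continuous f} -> {for x, continuous g} ->
  {for x, continuous (fun y => f y + g y)}.
Proof. exact: continuousD. Qed.

Lemma continuous_subr (f g : T -> R) (x : T) :
  {for x, continuous f} -> {for x, continuous g} ->
  {for x, continuous (fun y => f y - g y)}.
Proof. exact: continuousB. Qed.

Lemma continuous_mulr (f g : T -> R) (x : T) :
  {for x, continuous f} -> {for x, continuous g} ->
  {for x, continuous (fun y => f y * g y)}.
Proof. exact: continuousM. Qed.

Lemma continuous_addv (f g : T -> 'rV[R]_4) (x : T) :
  {for x, continuous f} -> {for x, continuous g} ->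
  {for x, continuous (fun y => f y + g y)}.
Proof. exact: continuousD. Qed.

Lemma continuous_subv (f g : T -> 'rV[R]_4) (x : T) :
  {for x, continuous f} -> {for x, continuous g} ->
  {for x, continuous (fun y => f y - g y)}.
Proof. exact: continuousB. Qed.

Lemma continuous_scalev (s : T -> R) (f : T -> 'rV[R]_4) (x : T) :
  {for x, continuous s} -> {for x, continuous f} ->
  {for x, continuous (fun y => s y *: f y)}.
Proof. exact: continuousZ. Qed.

End PointwiseContinuity.

Lemma continuous_eq {T U : topologicalType} (f g : T -> U) :
  f =1 g -> continuous g -> continuous f.
Proof. by move=> /funext ->. Qed.

(** The mean curvature is a rational expression in the derivatives of order at
    most two whose only denominator is the Gram determinant. *)
Section CurvatureContinuity.
Context {R : realType}.
Variable X : R * R -> 'rV[R]_4.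
Hypotheses (sX : smooth_on_open setT X) (DX : forall u, 0 < gram X u).

Let cX : continuous X.
Proof. by move=> u; exact: smooth_continuous sX _. Qed.

Let cX1 i : continuous (partial i X).
Proof. by move=> u; exact: smooth_continuous (smooth_on_open_derive _ sX) _. Qed.

Let cX2 i j : continuous (partial i (partial j X)).
Proof.
by move=> u; exact: smooth_continuous (smooth_on_open_derive _ (smooth_on_open_derive _ sX)) _.
Qed.

Let continuous_metric i j : continuous (fun u => dot (partial i X u) (partial j X u)).
Proof. by move=> u; apply: continuous_dot; exact: cX1. Qed.

Lemma continuous_gram : continuous (gram X).
Proof.
apply: (continuous_eq (gramE X)) => u.
have c i j := @continuous_metric i j u.
have cD := continuous_subr (continuous_mulr (c 0 0) (c 1 1)) (continuous_mulr (c 0 1) (c 1 0)).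
exact: cD.
Qed.

Lemma continuous_area_density : continuous (area_density X).
Proof.
by move=> u; apply: continuous_comp; [exact: continuous_gram|exact: sqrt_continuous].
Qed.

Let continuous_cometric i j : continuous (fun u => cometric X u i j).
Proof.
have cD : continuous (fun u => (gram X u)^-1).
  by move=> u; apply: continuousV; [rewrite gt_eqF|exact: continuous_gram].
have c k l : continuous (fun u => (gram X u)^-1 * dot (partial k X u) (partial l X u)).
  by move=> u; have h := continuous_mulr (cD u) (@continuous_metric k l u); exact: h.
have cN k l : continuous (fun u => (gram X u)^-1 * - dot (partial k X u) (partial l X u)).
  move=> u; have h := continuous_mulr (cD u) (continuousN (@continuous_metric k l u)).
  exact: h.
have e00 : (fun u => cometric X u 0 0) =1
    (fun u => (gram X u)^-1 * dot (partial 1 X u) (partial 1 X u)).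
  by move=> u; have [e _ _ _] := cometricE (DX u); exact: e.
have e01 : (fun u => cometric X u 0 1) =1
    (fun u => (gram X u)^-1 * - dot (partial 0 X u) (partial 1 X u)).
  by move=> u; have [_ e _ _] := cometricE (DX u); exact: e.
have e10 : (fun u => cometric X u 1 0) =1
    (fun u => (gram X u)^-1 * - dot (partial 1 X u) (partial 0 X u)).
  by move=> u; have [_ _ e _] := cometricE (DX u); exact: e.
have e11 : (fun u => cometric X u 1 1) =1
    (fun u => (gram X u)^-1 * dot (partial 0 X u) (partial 0 X u)).
  by move=> u; have [_ _ _ e] := cometricE (DX u); exact: e.
elim/ord2_ind: i; elim/ord2_ind: j.
- exact: (continuous_eq e00 (c 1 1)).
- exact: (continuous_eq e01 (cN 0 1)).
- exact: (continuous_eq e10 (cN 1 0)).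
- exact: (continuous_eq e11 (c 0 0)).
Qed.

Let continuous_sum (f : 'I_2 -> R * R -> 'rV[R]_4) :
  (forall i, continuous (f i)) -> continuous (fun u => \sum_i f i u).
Proof.
move=> cf; apply: (continuous_eq (fun u => sum_ord2 (f^~ u))) => u.
by have h := continuous_addv (cf 0 u) (cf 1 u); exact: h.
Qed.

Lemma continuous_mean_curvature : continuous (mean_curvature X).
Proof.
have c_normal i j : continuous (fun u => \sum_k \sum_l
    (cometric X u k l * dot (partial i (partial j X) u) (partial k X u)) *: partial l X u).
  apply: continuous_sum => k; apply: continuous_sum => l u.
  have h := continuous_scalev (continuous_mulr (@continuous_cometric k l u)
    (continuous_dot (@cX2 i j u) (@cX1 k u))) (@cX1 l u).
  exact: h.
apply: continuous_sum => i; apply: continuous_sum => j u.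
have h := continuous_scalev (@continuous_cometric i j u)
  (continuous_subv (continuous_subv (@cX2 i j u)
    (continuous_scalev (continuous_dot (@cX2 i j u) (@cX u)) (@cX u))) (@c_normal i j u)).
exact: h.
Qed.

End CurvatureContinuity.

Lemma is_derive_time_slice {R : realType} {V W : normedModType R} (f : R * V -> W)
    (t : R) (u : V) (d : W) :
  is_derive (t, u) (1, 0) f d -> is_derive (t : R) (1 : R) (fun s => f (s, u)) d.
Proof.
apply: is_derive_transport => h.
by congr (f (_, _)); rewrite /= scaler0 add0r.
Qed.

(** The derivative of the square root of [D = a 0 0 * a 1 1 - a 0 1 * a 1 0] when
    [a] has the derivative [a' = - (b + b^T)] is minus the trace of [b] with
    respect to [a], times [sqrt D]. In the application [a] is the metric and [b]
    the velocity paired with the second derivatives of the immersion; [p] and [q]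
    are [a] and [b] in the notation of the surface at a fixed time. *)
Lemma first_variation_algebra {R : realType} (a a' b p q : 'I_2 -> 'I_2 -> R) (D H : R) :
  0 < D -> a 1 0 = a 0 1 -> (forall i j, a' i j = - b i j - b j i) ->
  (forall i j, p i j = a i j) -> (forall i j, q i j = b i j) ->
  H = D^-1 * (p 1 1 * q 0 0 + p 0 0 * q 1 1 - p 0 1 * q 0 1 - p 1 0 * q 1 0) ->
  (a 0 0 * a' 1 1 + a 1 1 * a' 0 0 - (a 0 1 * a' 1 0 + a 1 0 * a' 0 1))
    / (2 * Num.sqrt D) = - H * Num.sqrt D.
Proof.
move=> D0 sym ea' ep eq ->; rewrite !ep !eq !ea' sym.
have s0 : Num.sqrt D != 0 by rewrite gt_eqF// sqrtr_gt0.
rewrite -{2}(sqr_sqrtr (ltW D0)).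
by field.
Qed.

(** A family of surfaces is a map [X] of space-time [R * (R * R)], smooth on an
    open set [Omega]; [slice t] is the surface at time [t]. *)
Section AreaEvolution.
Context {R : realType}.
Variables (Omega : set (R * (R * R))) (X : R * (R * R) -> 'rV[R]_4).
Hypotheses (oOmega : open Omega) (sX : smooth_on_open Omega X).

Let slice t u := X (t, u).
Let dir (i : 'I_2) : R * (R * R) := (0, if i == 0 then (1, 0) else (0, 1)).
Let time : R * (R * R) := (1, 0).

Let partial_slice (Y : R * (R * R) -> 'rV[R]_4) t i :
  partial i (fun u => Y (t, u)) = fun u => 'D_(dir i) Y (t, u).
Proof.
apply/funext => u; apply: derive_transport => h.
by congr (Y (_, _)); rewrite /= scaler0 add0r.
Qed.

Let space_gram (z : R * (R * R)) : R :=
  dot ('D_(dir 0) X z) ('D_(dir 0) X z) * dot ('D_(dir 1) X z) ('D_(dir 1) X z)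
  - dot ('D_(dir 0) X z) ('D_(dir 1) X z) * dot ('D_(dir 1) X z) ('D_(dir 0) X z).

Let gram_slice t u : gram (slice t) u = space_gram (t, u).
Proof. by rewrite gramE !partial_slice. Qed.

Let dgram (z : R * (R * R)) : R :=
  let a i j := dot ('D_(dir i) X z) ('D_(dir j) X z) in
  let a' i j := dot ('D_time ('D_(dir i) X) z) ('D_(dir j) X z)
              + dot ('D_(dir i) X z) ('D_time ('D_(dir j) X) z) in
  a 0 0 * a' 1 1 + a 1 1 * a' 0 0 - (a 0 1 * a' 1 0 + a 1 0 * a' 0 1).

Let is_derive_gram z : Omega z -> is_derive z time space_gram (dgram z).
Proof.
move=> Oz.
have d i : derivable ('D_(dir i) X) z time.
  exact: smooth_derivable (smooth_on_open_derive _ sX) Oz.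
have da i j := is_derive_dot (d i) (d j).
pose a i j y := dot ('D_(dir i) X y) ('D_(dir j) X y).
have -> : space_gram = a 0 0 * a 1 1 - a 0 1 * a 1 0 by [].
by apply: is_derive_eq; rewrite /dgram /GRing.scale.
Qed.

Let cD i z : Omega z -> {for z, continuous ('D_(dir i) X)}.
Proof. by move=> Oz; exact: smooth_continuous (smooth_on_open_derive _ sX) Oz. Qed.

Let cDt i z : Omega z -> {for z, continuous ('D_time ('D_(dir i) X))}.
Proof.
move=> Oz.
exact: smooth_continuous (smooth_on_open_derive _ (smooth_on_open_derive _ sX)) Oz.
Qed.

Let continuous_space_gram z : Omega z -> {for z, continuous space_gram}.
Proof.
move=> Oz; have c i j := continuous_dot (@cD i z Oz) (@cD j z Oz).
have h := continuous_subr (continuous_mulr (c 0 0) (c 1 1)) (continuous_mulr (c 0 1) (c 1 0)).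
exact: h.
Qed.

Let continuous_dgram z : Omega z -> {for z, continuous dgram}.
Proof.
move=> Oz.
have c i j := continuous_dot (@cD i z Oz) (@cD j z Oz).
have c' i j := continuous_addr (continuous_dot (@cDt i z Oz) (@cD j z Oz))
  (continuous_dot (@cD i z Oz) (@cDt j z Oz)).
have h := continuous_subr
  (continuous_addr (continuous_mulr (c 0 0) (c' 1 1)) (continuous_mulr (c 1 1) (c' 0 0)))
  (continuous_addr (continuous_mulr (c 0 1) (c' 1 0)) (continuous_mulr (c 1 0) (c' 0 1))).
exact: h.
Qed.

Hypothesis gram_pos : forall t u, Omega (t, u) -> 0 < gram (slice t) u.

Let space_gram_gt0 z : Omega z -> 0 < space_gram z.
Proof. by case: z => t u Oz; rewrite -gram_slice; exact: gram_pos. Qed.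

(** The time derivative of the area density before any use of the normality of
    the velocity: in this form its joint continuity in time and space is plain,
    and that is what allows differentiation under the integral. *)
Definition area_density_rate (z : R * (R * R)) : R :=
  dgram z / (2 * Num.sqrt (space_gram z)).

Lemma continuous_area_density_rate z : Omega z -> {for z, continuous area_density_rate}.
Proof.
move=> Oz.
have c : {for z, continuous (fun y => 2 * Num.sqrt (space_gram y))}.
  have h := continuous_comp (@continuous_space_gram z Oz) (@sqrt_continuous R _).
  have c2 : {for z, continuous (fun=> 2 : R)} by exact: cst_continuous.
  by have h2 := continuous_mulr c2 h; exact: h2.
have s0 : 2 * Num.sqrt (space_gram z) != 0.
  by rewrite mulf_neq0// gt_eqF// sqrtr_gt0 space_gram_gt0.
have h := continuous_mulr (@continuous_dgram z Oz) 
  (continuousV (s := fun y => 2 * Num.sqrt (space_gram y)) s0 c).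
exact: h.
Qed.

Lemma is_derive_area_density t u : Omega (t, u) ->
  is_derive (t : R) (1 : R) (fun s => area_density (slice s) u) (area_density_rate (t, u)).
Proof.
move=> Oz.
have dg := is_derive_time_slice (is_derive_gram Oz).
rewrite (_ : (fun s => _) = Num.sqrt \o (fun s => space_gram (s, u))); last first.
  by apply/funext => s; rewrite /= -gram_slice.
rewrite /area_density_rate mulrC; apply: is_derive1_comp => //.
exact/is_derive1_sqrt/space_gram_gt0.
Qed.

Hypothesis normal_velocity : forall z v, Omega z ->
  dot ('D_time X z) ('D_(0, v) X z) = 0.

(** Differentiate [dot (d_t X) (d_j X) = 0] in the direction [i], and exchange
    the time derivative with the space derivative. *)
Let dot_velocity_derivative i j z : Omega z ->
  dot ('D_time ('D_(dir i) X) z) ('D_(dir j) X z) =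
  - dot ('D_time X z) ('D_(dir i) ('D_(dir j) X) z).
Proof.
move=> Oz.
have d1 : derivable ('D_time X) z (dir i).
  exact: smooth_derivable (smooth_on_open_derive _ sX) Oz.
have d2 : derivable ('D_(dir j) X) z (dir i).
  exact: smooth_derivable (smooth_on_open_derive _ sX) Oz.
have [_ E] := is_derive_dot d1 d2.
have comm := smooth_derive_comm time (dir i) oOmega sX Oz.
apply/eqP; rewrite -addr_eq0; apply/eqP.
apply: etrans (congr1 (fun w => dot w ('D_(dir j) X z)
  + dot ('D_time X z) ('D_(dir i) ('D_(dir j) X) z)) comm) _.
apply: etrans (esym E) _.
have near0 : \forall y \near z, dot ('D_time X y) ('D_(dir j) X y) = cst 0 y.
  by have := open_nbhs_nbhs (conj oOmega Oz); apply: filterS => y; exact: normal_velocity.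
apply: etrans (near_eq_derive (dir i) near0) _.
exact: derive_cst.
Qed.

(** First variation of area: a normal velocity [v] changes the area density at
    the rate [- dot v H] times the density. *)
Lemma area_density_rateE t u : Omega (t, u) ->
  dot ('D_time X (t, u)) (slice t u) = 0 ->
  area_density_rate (t, u) =
  - dot ('D_time X (t, u)) (mean_curvature (slice t) u) * area_density (slice t) u.
Proof.
move=> Oz n0.
have nt i : dot ('D_time X (t, u)) (partial i (slice t) u) = 0.
  by rewrite partial_slice; exact: normal_velocity.
have p1 i : partial i (slice t) u = 'D_(dir i) X (t, u) by rewrite partial_slice.
have p2 i j : partial i (partial j (slice t)) u = 'D_(dir i) ('D_(dir j) X) (t, u).
  have -> : partial j (slice t) = fun u => 'D_(dir j) X (t, u) by exact: partial_slice.
  by rewrite (@partial_slice ('D_(dir j) X)).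
have D0 := gram_pos Oz.
have ea i j : dot (partial i (slice t) u) (partial j (slice t) u) =
    dot ('D_(dir i) X (t, u)) ('D_(dir j) X (t, u)).
  exact (congr2 (@dot R) (p1 i) (p1 j)).
have eb i j : dot ('D_time X (t, u)) (partial i (partial j (slice t)) u) =
    dot ('D_time X (t, u)) ('D_(dir i) ('D_(dir j) X) (t, u)).
  exact (congr1 (dot ('D_time X (t, u))) (p2 i j)).
have ea' i j : dot ('D_time ('D_(dir i) X) (t, u)) ('D_(dir j) X (t, u)) +
    dot ('D_(dir i) X (t, u)) ('D_time ('D_(dir j) X) (t, u)) =
    - dot ('D_time X (t, u)) ('D_(dir i) ('D_(dir j) X) (t, u))
    - dot ('D_time X (t, u)) ('D_(dir j) ('D_(dir i) X) (t, u)).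
  exact (congr2 (fun x y : R => x + y) (@dot_velocity_derivative i j (t, u) Oz)
    (etrans (dotC _ _) (@dot_velocity_derivative j i (t, u) Oz))).
have H := first_variation_algebra D0 (dotC _ _) ea' ea eb
  (dot_mean_curvature D0 n0 nt).
rewrite /area_density_rate -gram_slice.
exact: H.
Qed.

End AreaEvolution.

(** * Measures with a density *)
Section PlaneMeasurability.
Context {R : realType}.

(** An open set of the plane is the union of the rational squares, given by a
    rational centre and radius, that it contains. *)
Lemma open_plane_measurable (U : set (R * R)) : open U -> measurable U.
Proof.
move=> oU.
pose box (q : rat * rat * rat) : set (R * R) :=
  ball (ratr q.1.1 : R) (ratr q.2 : R) `*` ball (ratr q.1.2 : R) (ratr q.2 : R).
have -> : U = \bigcup_q (if `[< box q `<=` U >] then box q else set0).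
  apply/seteqP; split=> [x Ux|x [q _]]; last by case: asboolP => // qU /qU.
  have /nbhs_ballP[e /= e0 eU] : nbhs x U by exact: open_nbhs_nbhs.
  have e2 : 0 < e / 2 by rewrite divr_gt0.
  have [r] := rat_in_itvoo e2; rewrite in_itv/= => /andP[r0 re].
  have near_rat (y : R) : exists q : rat, ball (ratr q : R) (ratr r : R) y.
    have : y - ratr r < y + ratr r by rewrite ltrD2l gt0_cp.
    move=> /rat_in_itvoo[q]; rewrite in_itv/= => /andP[h1 h2]; exists q.
    by rewrite /ball/= ltr_distlC; apply/andP; split; lra.
  have [q1 h1] := near_rat x.1; have [q2 h2] := near_rat x.2.
  exists (q1, q2, r) => //; case: asboolP => [_|]; first by [].
  case=> y [/= y1 y2]; apply: eU; split.
    apply: (@le_ball _ _ _ (ratr r + ratr r)); first lra.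
    by apply: ball_triangle y1; exact: ball_sym.
  apply: (@le_ball _ _ _ (ratr r + ratr r)); first lra.
  by apply: ball_triangle y2; exact: ball_sym.
apply: countable_bigcupT_measurable => // q.
case: asboolP => // _; by apply: measurableX; exact: measurable_ball.
Qed.

Lemma continuous_plane_measurable (f : R * R -> R) :
  continuous f -> measurable_fun setT f.
Proof.
move=> /continuousP cf; apply: (measurability _ (RGenOpens.measurableE R)).
move=> _ [_ [a [b ->] <-]]; rewrite setTI; apply: open_plane_measurable.
exact/cf/interval_open.
Qed.

End PlaneMeasurability.

(** The image under [phi] of the measure with density [r] on [Q]. Integrals
    against it are computed for indicators, then for simple functions, then for
    nonnegative functions by monotone convergence; the signed case follows since
    [r] is nonnegative, so that positive and negative parts are preserved. *)
Section Density.
Local Open Scope ereal_scope.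
Context d1 d2 (X : measurableType d1) (Y : measurableType d2) (R : realType).
Variables (mu : {measure set X -> \bar R}) (Q : set X) (r : X -> R) (phi : X -> Y).
Hypotheses (mQ : measurable Q) (mr : measurable_fun setT r) (r0 : forall x, (0 <= r x)%R).
Hypothesis mphi : measurable_fun setT phi.

Definition density_image (B : set Y) : \bar R :=
  \int[mu]_(x in Q `&` phi @^-1` B) (r x)%:E.

Let mer D : measurable_fun D (EFin \o r).
Proof. exact/measurable_EFinP/measurable_funTS. Qed.

Let mpre B : measurable B -> measurable (phi @^-1` B).
Proof. by move=> mB; rewrite -[_ @^-1` _]setTI; exact: mphi. Qed.

Let density_image0 : density_image set0 = 0.
Proof. by rewrite /density_image preimage_set0 setI0 integral_set0. Qed.

Let density_image_ge0 B : 0 <= density_image B.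
Proof. by apply: integral_ge0 => x _; rewrite lee_fin. Qed.

Let density_image_sigma_additive : semi_sigma_additive density_image.
Proof.
move=> F mF tF mUF; rewrite /density_image preimage_bigcup setI_bigcupr.
rewrite ge0_integral_bigcup//=.
- apply: is_cvg_ereal_nneg_natsum_cond => // n _ _.
  exact: density_image_ge0.
- by move=> k; apply: measurableI => //; exact: mpre.
- by move=> x _; rewrite lee_fin.
- apply/trivIsetP => i j _ _ ij; rewrite setIACA setIid -preimage_setI.
  by move/trivIsetP : tF => -> //; rewrite preimage_set0 setI0.
Qed.

Let nu : {measure set Y -> \bar R} := HB.pack density_image
  (isMeasure.Build _ _ _ density_image density_image0 density_image_ge0
     density_image_sigma_additive).

Let integral_indic_density E : measurable E ->
  \int[nu]_x (\1_E x)%:E = \int[mu]_(x in Q) (\1_E (phi x) * r x)%:E.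
Proof.
move=> mE; rewrite integral_indic// setIT.
transitivity (density_image E); first by [].
rewrite /density_image integral_mkcondr; apply: eq_integral => x _.
rewrite patchE /= indicE -[phi x \in E]/(x \in phi @^-1` E).
by case: (x \in _); rewrite ?mul1r ?mul0r.
Qed.

Let mphiQ (h : Y -> R) : measurable_fun setT h ->
  measurable_fun Q (fun x => (h (phi x) * r x)%:E).
Proof.
move=> mh; apply/measurable_EFinP/measurable_funTS/measurable_funM => //.
exact: measurableT_comp.
Qed.

Import HBNNSimple.

Let integral_nnsfun_density (h : {nnsfun Y >-> R}) :
  \int[nu]_x (h x)%:E = \int[mu]_(x in Q) (h (phi x) * r x)%:E.
Proof.
under [LHS]eq_integral do rewrite fimfunE -fsumEFin//.
rewrite [LHS]ge0_integral_fsum//; last 2 first.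
  - by move=> c; exact/measurable_EFinP/measurableT_comp.
  - by move=> n x _; rewrite EFinM nnfun_muleindic_ge0.
under [RHS]eq_integral.
  move=> x xD; rewrite fimfunE EFinM -fsumEFin// muleC ge0_mule_fsumr; last first.
    by move=> c; rewrite EFinM nnfun_muleindic_ge0.
  over.
rewrite [RHS]ge0_integral_fsum//; last 2 first.
  - move=> c; under eq_fun do rewrite -EFinM mulrC.
    by apply: (@mphiQ (fun y => c * \1_(h @^-1` [set c]) y)%R); exact/measurable_funM.
  - move=> c x _; apply: mule_ge0; first by rewrite lee_fin.
    by rewrite EFinM nnfun_muleindic_ge0.
apply: eq_fsbigr => c _.
have [c0|c0] := ltP c 0%R.
  rewrite preimage_nnfun0// indic0.
  by rewrite !integral0_eq// => x _; rewrite ?mulr0 ?mule0.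
transitivity (c%:E * \int[nu]_x (\1_(h @^-1` [set c]) x)%:E).
  rewrite -ge0_integralZl//; first by apply/measurable_EFinP; exact: measurable_indic.
rewrite integral_indic_density// -ge0_integralZl//.
- by apply: eq_integral => x _; rewrite -!EFinM; congr (_%:E); ring.
- exact: mphiQ.
- by move=> x _; rewrite lee_fin mulr_ge0.
Qed.

Lemma ge0_integral_density (h : Y -> R) : measurable_fun setT h ->
  (forall y, (0 <= h y)%R) ->
  \int[density_image]_x (h x)%:E = \int[mu]_(x in Q) (h (phi x) * r x)%:E.
Proof.
move=> mh h0.
have meh : measurable_fun setT (EFin \o h) by exact/measurable_EFinP.
pose h_ := nnsfun_approx measurableT meh.
have h_cvg y : EFin \o h_ ^~ y @ \oo --> (h y)%:E.
  by apply: cvg_nnsfun_approx => // x _; rewrite lee_fin.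
have h_nd y : {homo (fun n => (h_ n y)%:E) : m n / (m <= n)%N >-> m <= n}.
  by move=> m n mn; rewrite lee_fin; exact/lefP/nd_nnsfun_approx.
transitivity (\int[nu]_x (h x)%:E); first by [].
transitivity (limn (fun n => \int[nu]_x (h_ n x)%:E)).
  rewrite -monotone_convergence//.
  - by apply: eq_integral => y _; apply/esym/cvg_lim => //; exact: h_cvg.
  - by move=> n; exact/measurable_EFinP/measurable_funTS.
  - by move=> n x _; rewrite lee_fin.
transitivity (limn (fun n => \int[mu]_(x in Q) (h_ n (phi x) * r x)%:E)).
  by congr (limn _); apply/funext => n; exact: integral_nnsfun_density.
rewrite -monotone_convergence//.
- apply: eq_integral => x _; apply/cvg_lim => //.
  rewrite EFinM; under eq_fun do rewrite EFinM.
  by apply: cvgeZr => //; exact: h_cvg.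
- by move=> n; exact: mphiQ.
- by move=> n x _; rewrite lee_fin mulr_ge0.
- by move=> x _ m n mn; rewrite lee_fin ler_wpM2r// -lee_fin; exact: h_nd.
Qed.

Lemma integral_density (h : Y -> R) : measurable_fun setT h ->
  \int[density_image]_x (h x)%:E = \int[mu]_(x in Q) (h (phi x) * r x)%:E.
Proof.
move=> mh.
transitivity (\int[nu]_x (h^\+ x)%:E - \int[nu]_x (h^\- x)%:E).
  transitivity (\int[nu]_x (h x)%:E); first by [].
  rewrite integralE; congr (_ - _); apply: eq_integral => x _.
    by rewrite funeposE /funrpos EFin_max.
  by rewrite funenegE /funrneg EFin_max.
rewrite [RHS]integralE; congr (_ - _).
  apply: etrans (ge0_integral_density _ _) _.
  - exact: measurable_funrpos.
  - by move=> y; exact: funrpos_ge0.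
  apply: eq_integral => x _; rewrite funeposE /funrpos -EFin_max; congr (_%:E).
  by rewrite -[in RHS](mul0r (r x)) -maxr_pMl.
apply: etrans (ge0_integral_density _ _) _.
- exact: measurable_funrneg.
- by move=> y; exact: funrneg_ge0.
apply: eq_integral => x _; rewrite funenegE /funrneg -EFinN -EFin_max; congr (_%:E).
by rewrite -[in RHS](mul0r (r x)) -mulNr -maxr_pMl.
Qed.

End Density.

(** * Integration over the torus *)
Section UnitSquare.
Context {R : realType}.

Definition plane_measure :
    {measure set (measurableTypeR R * measurableTypeR R) -> \bar R} :=
  (lebesgue_measure \x lebesgue_measure)%E.

Lemma measurable_unit_square :
  measurable (unit_square : set (measurableTypeR R * measurableTypeR R)).
Proof. by apply: measurableX; exact: measurable_itv. Qed.

Lemma unit_square_finite : (plane_measure (@unit_square R) < +oo)%E.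
Proof.
have -> : plane_measure (@unit_square R) =
    (lebesgue_measure `[0%R, 1%R[%classic * lebesgue_measure `[0%R, 1%R[%classic)%E.
  by apply: product_measure1E; exact: measurable_itv.
by rewrite lebesgue_measure_itv /= lte_fin ltr01 -EFinB -EFinM ltry.
Qed.

(** The fundamental domain is not compact; bounds for continuous functions are
    taken on its closure. *)
Definition closed_square : set (R * R) := `[0, 1]%classic `*` `[0, 1]%classic.

Lemma unit_square_closed : unit_square `<=` closed_square.
Proof.
by move=> u [/=]; rewrite !in_itv/= => /andP[a0 a1] /andP[b0 b1];
  split; rewrite /= in_itv/= ?a0 ?b0 ltW.
Qed.

Lemma compact_closed_square : compact closed_square.
Proof. by apply: compact_setX; exact: segment_compact. Qed.

Lemma compact_bound {T : topologicalType} (K : set T) (g : T -> R) :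
  compact K -> (forall x, K x -> {for x, continuous g}) ->
  exists2 M, 0 <= M & forall x, K x -> `|g x| <= M.
Proof.
move=> cK cg; have [->|/set0P K0] := eqVneq K set0.
  by exists 0 => // x [].
have cn : {within K, continuous (fun x => `|g x|)}.
  apply: continuous_in_subspaceT => x /set_mem Kx.
  by apply: (continuous_comp (cg x Kx)); exact: norm_continuous.
have [c _ cM] := compact_EVT_max K0 cK cn.
by exists `|g c| => // x Kx; apply: cM; exact: mem_set.
Qed.

Lemma integrable_bounded_continuous (s g : R * R -> R) :
  measurable_fun setT s -> (forall u, `|s u| <= 1) -> continuous g ->
  plane_measure.-integrable unit_square (EFin \o (fun u => s u * g u)).
Proof.
move=> ms s1 cg.
apply: measurable_bounded_integrable.
- exact: measurable_unit_square.
- exact: unit_square_finite.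
- apply: measurable_funTS; apply: measurable_funM => //.
  exact: continuous_plane_measurable.
have [M M0 gM] := compact_bound compact_closed_square (fun x _ => cg x).
exists M; split; first exact: num_real.
move=> x Mx u /= /unit_square_closed uQ; rewrite (le_trans _ (ltW Mx))//.
by rewrite normrM -[leRHS]mul1r ler_pM//; exact: gM.
Qed.

Lemma integrable_continuous (g : R * R -> R) : continuous g ->
  plane_measure.-integrable unit_square (EFin \o g).
Proof.
move=> cg; have := @integrable_bounded_continuous (cst 1) g.
rewrite (_ : (fun u => cst 1 u * g u) = g); last by apply/funext => u; rewrite mul1r.
by apply => // u; rewrite normr1.
Qed.

End UnitSquare.

Section Torus.
Context {R : realType} {S : ptopologicalType} (p : R * R -> S).
Hypothesis hp : torus_covering p.

Lemma measurable_covering : measurable_fun setT (p : R * R -> borel S).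
Proof.
apply: (measurability _ (erefl : @measurable _ (borel S) = <<s open >>)).
move=> _ [U oU <-]; rewrite setTI; apply: open_plane_measurable.
exact/(covering_open hp).
Qed.

(** The torus carries the quotient topology. *)
Lemma continuous_from_covering (h : S -> R) : continuous (h \o p) -> continuous h.
Proof.
move=> /continuousP ch; apply/continuousP => U oU.
by apply/(covering_open hp); exact: ch.
Qed.

Lemma continuous_borel_measurable (h : S -> R) : continuous h ->
  measurable_fun setT (h : borel S -> R).
Proof.
move=> /continuousP ch; apply: (measurability _ (RGenOpens.measurableE R)).
move=> _ [_ [a [b ->] <-]]; rewrite setTI; apply: sub_sigma_algebra.
exact/ch/interval_open.
Qed.

Lemma measurable_lift (h : borel S -> R) :
  measurable_fun setT h -> measurable_fun setT (h \o p : R * R -> R).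
Proof. by move=> mh; exact: (measurableT_comp mh measurable_covering). Qed.

Lemma integral_area_measure (f : S -> 'rV[R]_4) (h : borel S -> R) :
  continuous (area_density (f \o p)) -> measurable_fun setT h ->
  (\int[area_measure p f]_(x in [set: borel S]) (h x)%:E =
   \int[plane_measure]_(u in unit_square) (h (p u) * area_density (f \o p) u)%:E)%E.
Proof.
move=> cr mh.
exact (@integral_density _ _ _ (borel S) R plane_measure unit_square (area_density (f \o p)) p
  measurable_unit_square (continuous_plane_measurable cr) (fun u => sqrtr_ge0 _)
  measurable_covering h mh).
Qed.

Lemma area_measure_indicator (f : S -> 'rV[R]_4) (B : set (borel S)) : measurable B ->
  area_measure p f B =
  (\int[plane_measure]_(u in unit_square) (\1_B (p u) * area_density (f \o p) u)%:E)%E.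
Proof.
move=> mB; rewrite /area_measure integral_mkcondr; apply: eq_integral => u _.
rewrite patchE indicE -[p u \in B]/(u \in p @^-1` B).
by case: (u \in _); rewrite ?mul1r ?mul0r.
Qed.

(** Two preimages of a point differ by a vector of the lattice Z^2, and all such
    vectors are periods of [p]. *)
Lemma covering_lift_periodic (x : S) (u : R * R) : p u = x ->
  forall v, p (v + (covering_lift p x - u)) = p v.
Proof.
move=> <- v; have : [set w | p w = p u] (covering_lift p (p u)).
  by apply: xgetPex; exists u.
move=> /= /(covering_fiber hp)[m [n [e1 e2]]].
apply/(covering_fiber hp); exists m, n.
by rewrite -e1 -e2 /= ![v.1 + _]addrC ![v.2 + _]addrC !addrK.
Qed.

Lemma sqH_lift (f : S -> 'rV[R]_4) (u : R * R) :
  let H := mean_curvature (f \o p) u in sqH p f (p u) = dot H H.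
Proof.
rewrite /sqH; set w := covering_lift p (p u).
have -> : w = u + (w - u) by rewrite addrC subrK.
rewrite mean_curvature_periodic// => v /=.
by rewrite covering_lift_periodic.
Qed.

End Torus.

(** * The Willmore energy in the covering *)
Section Immersed.
Context {R : realType} {S : ptopologicalType} (p : R * R -> S).
Hypothesis hp : torus_covering p.
Variable f : S -> 'rV[R]_4.
Hypothesis immf : immersion p f.

Lemma immersion_smooth : smooth_on_open setT (f \o p).
Proof. by case: immf => sf _ _; apply: smooth_on_openP sf; exact: openT. Qed.

Lemma immersion_gram_gt0 u : 0 < gram (f \o p) u.
Proof.
case: immf => _ _ inj; apply: gram_gt0; [exact: immersion_smooth|exact: inj].
Qed.

Lemma immersion_continuous_area : continuous (area_density (f \o p)).
Proof. exact: continuous_area_density immersion_smooth. Qed.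

Definition willmore_density u : R :=
  let H := mean_curvature (f \o p) u in (1 + dot H H / 4) * area_density (f \o p) u.

Lemma continuous_sqnorm_mean_curvature :
  continuous (fun u => let H := mean_curvature (f \o p) u in dot H H).
Proof.
have cH := continuous_mean_curvature immersion_smooth immersion_gram_gt0.
by move=> u; exact: continuous_dot (cH u) (cH u).
Qed.

Lemma continuous_willmore_integrand :
  continuous (fun u => let H := mean_curvature (f \o p) u in 1 + dot H H / 4).
Proof.
move=> u.
have c1 : {for u, continuous (fun=> 1 : R)} by exact: cst_continuous.
have c4 : {for u, continuous (fun=> 4^-1 : R)} by exact: cst_continuous.
have h := continuous_addr c1 (continuous_mulr (@continuous_sqnorm_mean_curvature u) c4).
exact: h.
Qed.

Lemma continuous_willmore_density : continuous willmore_density.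
Proof.
move=> u.
have h := continuous_mulr (@continuous_willmore_integrand u) (@immersion_continuous_area u).
exact: h.
Qed.

Lemma willmoreE : willmore p f = \int[plane_measure]_(u in unit_square) willmore_density u.
Proof.
have lift : (fun x => 1 + sqH p f x / 4) \o p =
    fun u => let H := mean_curvature (f \o p) u in 1 + dot H H / 4.
  by apply/funext => u /=; rewrite sqH_lift.
have mh : measurable_fun setT (fun x : borel S => 1 + sqH p f x / 4).
  apply: continuous_borel_measurable; apply: (continuous_from_covering hp).
  by rewrite lift; exact: continuous_willmore_integrand.
have E u : (1 + sqH p f (p u) / 4) * area_density (f \o p) u = willmore_density u.
  by rewrite -[1 + _]/(((fun x => 1 + sqH p f x / 4) \o p) u) lift.
rewrite /willmore (integral_area_measure hp immersion_continuous_area mh).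
exact (congr1 (fun g : R * R -> R =>
  fine (\int[plane_measure]_(u in unit_square) (g u)%:E)%E) (funext E)).
Qed.

End Immersed.

(** * One-variable estimates *)
Lemma open_lt_ereal {R : realType} (T : \bar R) : open [set t : R | (t%:E < T)%E].
Proof.
case: T => [r| |].
- rewrite (_ : [set t | _] = [set t | t < r]); first exact: open_lt.
  by apply/seteqP; split => t /=; rewrite lte_fin.
- rewrite (_ : [set t | _] = setT); first exact: openT.
  by apply/seteqP; split => t //= _; exact: ltry.
- rewrite (_ : [set t | _] = set0); first exact: open0.
  by apply/seteqP; split => t //=; rewrite ltNge leNye.
Qed.

Lemma derive_nonincreasing {R : realType} (f f' : R -> R) (s t : R) : s <= t ->
  (forall r, s <= r <= t -> is_derive (r : R) (1 : R) f (f' r) /\ f' r <= 0) -> f t <= f s.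
Proof.
move=> st df.
have oc r : r \in `]s, t[ -> s <= r <= t.
  by rewrite in_itv/= => /andP[h1 h2]; rewrite !ltW.
apply: (@ler0_derive1_le_cc _ f s t).
- by move=> r /oc /df[[]].
- by move=> r /oc /df[[_ e] h]; rewrite derive1E e.
- by apply: derivable_within_continuous => r; rewrite in_itv/= => /df[[]].
- by rewrite in_itv/= lexx st.
- by rewrite in_itv/= lexx st.
- exact: st.
Qed.

(** The bound is the infimum over [l] of the right-hand side, which need not be
    attained when [A] or [D] vanishes; hence weights that depend on [a] instead of
    the minimiser. *)
Lemma weighted_minimum {R : realType} (A D a : R) : 0 <= A -> 0 <= D ->
  (forall l, 0 < l -> a <= 2 * l * A + (2 * l)^-1 * D) -> a <= 2 * Num.sqrt (A * D).
Proof.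
move=> A0 D0 h; have [a0|a0] := lerP a 0.
  by rewrite (le_trans a0)// mulr_ge0// sqrtr_ge0.
have : a ^+ 2 <= 2 ^+ 2 * (A * D).
  have [A1|A1] := ltrP 0 A.
    (* With this weight the first term is a / 2, and no square root appears. *)
    have l0 : 0 < a / (4 * A) by rewrite divr_gt0// mulr_gt0.
    have := h _ l0.
    have -> : 2 * (a / (4 * A)) * A + (2 * (a / (4 * A)))^-1 * D = a / 2 + 2 * A * D / a.
      by field; rewrite !gt_eqF.
    move=> h1; have : a / 2 <= 2 * A * D / a by lra.
    by rewrite ler_pdivlMr// => h2; lra.
  have A2 : A = 0 by apply/eqP; rewrite eq_le A1 A0.
  rewrite A2 in h *; move: D0; rewrite le_eqVlt => /orP[/eqP D1|D1].
    by have := h 1 ltr01; rewrite -D1; lra.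
  (* The first term vanishes for A = 0; this weight makes the second a / 2. *)
  have := h (D / a) (divr_gt0 D1 a0).
  have -> : 2 * (D / a) * 0 + (2 * (D / a))^-1 * D = a / 2 by field; rewrite !gt_eqF.
  by lra.
move=> /ler_wsqrtr; rewrite (sqrtrM _ (sqr_ge0 2)) !sqrtr_sqr.
by rewrite (ger0_norm (ltW a0)) ger0_norm.
Qed.

(** Continuity of [V (e ^ 2)] at [e = 0] is right continuity of [V] at [0]. *)
Lemma initial_value_bound {R : realType} (V : R -> R) (t : R) : 0 < t ->
  {for 0, continuous (fun e : R => V (e ^+ 2))} ->
  (forall r, 0 < r -> r <= t -> V t <= V r) -> V t <= V 0.
Proof.
move=> t0 cV mono; rewrite leNgt; apply/negP => lt0.
have e0 : 0 < V t - V 0 by rewrite subr_gt0.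
have /cvgrPdist_lt/(_ _ e0)/nbhs_ballP[r /= r0 rP] := cV.
pose e := Num.min (r / 2) (Num.min 1 t).
have e_gt0 : 0 < e by rewrite !lt_min ltr01 t0 divr_gt0.
have et : e ^+ 2 <= t.
  have e1 : e <= 1 by rewrite /e !ge_min lexx orbT.
  have e2 : e <= t by rewrite /e !ge_min lexx !orbT.
  by apply: le_trans e2; rewrite expr2 ler_piMl// ltW.
have : `|V (0 ^+ 2) - V (e ^+ 2)| < V t - V 0.
  apply: rP; rewrite -ball_normE /= sub0r normrN gtr0_norm//.
  by rewrite /e gt_min ltr_pdivrMr// ltr_pMr// ltr1n.
rewrite expr0n /= ltr_norml => /andP[Ve _].
by have := mono _ (exprn_gt0 2 e_gt0) et; lra.
Qed.

(** A substitute for the Cauchy-Schwarz inequality in time: for each weight [l]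
    the hypothesis makes [k * I + W / (2 c0 l)], minus a multiple of time,
    nonincreasing for every [k] between [-1] and [1], and the weight is optimised
    only after the endpoints have been compared. *)
Lemma dissipation_estimate {R : realType} (I W i w : R -> R) (c0 W0 s t : R) :
  0 < c0 -> 0 <= W0 -> s < t -> W t <= W s ->
  (forall r, s <= r <= t -> [/\ is_derive (r : R) (1 : R) I (i r),
     is_derive (r : R) (1 : R) W (w r), W r <= W0 &
     forall l, 0 < l -> `|i r| <= 2 * l / c0 * W r - (2 * c0 * l)^-1 * w r]) ->
  `|I t - I s| <= 2 * Num.sqrt W0 / c0 * Num.sqrt ((t - s) * (W s - W t)).
Proof.
move=> c0_gt0 W0_ge0 st Wst rates.
have key (k l : R) : `|k| <= 1 -> 0 < l -> k * (I t - I s) <=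
    2 * l / c0 * (W0 * (t - s)) + (2 * c0 * l)^-1 * (W s - W t).
  move=> k1 l0.
  pose N : R -> R := k \*: I + (2 * c0 * l)^-1 \*: W - (2 * l / c0 * W0) \*: id.
  have dN r : s <= r <= t -> is_derive (r : R) (1 : R) N
      (k * i r + (2 * c0 * l)^-1 * w r - 2 * l / c0 * W0) /\
      k * i r + (2 * c0 * l)^-1 * w r - 2 * l / c0 * W0 <= 0.
    move=> /rates[d1 d2 Wr h]; split.
      by apply: is_derive_eq; rewrite /GRing.scale/= mulr1.
    have ki : k * i r <= `|i r|.
      by rewrite (le_trans (ler_norm _))// normrM ler_piMl.
    have WW : 2 * l / c0 * W r <= 2 * l / c0 * W0.
      by rewrite ler_wpM2l// divr_ge0 ?ltW// mulr_gt0.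
    by have := h l l0; lra.
  have := derive_nonincreasing (ltW st) dN.
  have NE r : N r = k * I r + (2 * c0 * l)^-1 * W r - (2 * l / c0 * W0) * r by [].
  by rewrite !NE; lra.
have bound (k : R) : `|k| <= 1 ->
    k * (I t - I s) * c0 <= 2 * Num.sqrt (W0 * (t - s) * (W s - W t)).
  move=> k1; apply: weighted_minimum.
  - by rewrite mulr_ge0// subr_ge0 ltW.
  - by rewrite subr_ge0.
  move=> l l0; have := key k l k1 l0; rewrite -(ler_pM2r c0_gt0) => /le_trans; apply.
  rewrite le_eqVlt; apply/orP; left; apply/eqP; field.
  by rewrite !gt_eqF.
have -> : 2 * Num.sqrt W0 / c0 * Num.sqrt ((t - s) * (W s - W t)) =
    2 * Num.sqrt (W0 * (t - s) * (W s - W t)) / c0.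
  by rewrite -[W0 * _ * _]mulrA (sqrtrM _ W0_ge0); field; rewrite gt_eqF.
rewrite ler_pdivlMr// -{1}(ger0_norm (ltW c0_gt0)) -normrM ler_norml.
have b1 := bound 1; have b2 := bound (-1).
rewrite normrN normr1 mulN1r mulNr in b2; rewrite normr1 mul1r in b1.
by rewrite lerNl b1 ?b2.
Qed.

(** * Evolution of energy and area along the flow *)
Section Flow.
Context {R : realType} {S : ptopologicalType} (p : R * R -> S).
Hypothesis hp : torus_covering p.
Variables (T : \bar R) (F G : R -> S -> 'rV[R]_4).
Hypothesis T_gt0 : (0 < T)%E.
Hypothesis smooth_flow :
  smooth_on [set z : R * (R * R) | 0 <= z.1 /\ (z.1%:E < T)%E]
    (fun z => F z.1 (p z.2)).
Hypothesis immersed : forall t, 0 <= t -> (t%:E < T)%E -> immersion p (F t).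
Hypothesis gradient : forall t, 0 <= t -> (t%:E < T)%E -> is_L2_gradient p (F t) (G t).
Hypothesis evolution : forall t, 0 <= t -> (t%:E < T)%E -> forall x,
  h^-1 *: (F (t + h) x - F t x) @[h --> within [set h | 0 <= t + h] 0^'] -->
    - ((sqA0 p (F t) x) ^- 2 *: G t x).

Let W t := willmore p (F t).
Let X (z : R * (R * R)) := F z.1 (p z.2).
Let velocity t x := - ((sqA0 p (F t) x) ^- 2 *: G t x).
Let time_interval : set R := [set t | 0 < t /\ (t%:E < T)%E].
Let Omega : set (R * (R * R)) := [set z | time_interval z.1].

Let open_time_interval : open time_interval.
Proof. by apply: openI; [exact: open_gt|exact: open_lt_ereal]. Qed.

Let open_Omega : open Omega.
Proof. by apply: open_comp open_time_interval => z _; exact: cvg_fst. Qed.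

Let smooth_X : smooth_on_open Omega X.
Proof.
apply: smooth_on_openP => // z [z0 zT].
have [U [g [oU Uz sg gX]]] := smooth_flow (conj (ltW z0) zT).
exists U, g; split => // y [y0 yT] Uy; apply: gX => //.
by split => //; exact: ltW.
Qed.

Let is_derive_flow t x : time_interval t ->
  is_derive (t : R) (1 : R) (fun s => F s x) (velocity t x).
Proof.
move=> [t0 tT].
suff : h^-1 *: (((fun s => F s x) \o shift t) (h *: (1 : R)) - F t x) @[h --> 0^'] -->
    velocity t x.
  by move=> cv; split; [apply/cvg_ex; exists (velocity t x)|exact/cvg_lim].
rewrite [X in X @ _](_ : _ = fun h : R => h^-1 *: (F (t + h) x - F t x)); last first.
  by apply/funext => h /=; rewrite [h *: _]mulr1 [h + t]addrC.
move=> P /(evolution (ltW t0) tT) /= nP.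
(* For t > 0 the constraint 0 <= t + h holds for all small h. *)
have nA : \forall h \near (0 : R)^', 0 <= t + h.
  by near=> h; have : `|h| < t; [near: h; exact: dnbhs0_lt|rewrite ltr_norml; lra].
have nP' : \forall h \near (0 : R)^', 0 <= t + h -> P (h^-1 *: (F (t + h) x - F t x)) := nP.
change (\forall h \near (0 : R)^', P (h^-1 *: (F (t + h) x - F t x))).
by near=> h; have : 0 <= t + h; near: h.
Unshelve. all: end_near. Qed.

Let is_derive_shifted_flow t x : time_interval t ->
  is_derive (0 : R) (1 : R) (fun e => F (t + e) x) (velocity t x).
Proof.
move=> It; apply: (@is_derive_transport _ _ _ _ (fun s => F s x) (fun e => F (t + e) x) t 1).
  by move=> h; rewrite addr0 addrC.
exact: is_derive_flow.
Qed.

Let velocityE t u : time_interval t -> 'D_(1, 0) X (t, u) = velocity t (p u).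
Proof.
move=> It.
have [_ <-] := is_derive_flow (p u) It.
have d1 : derivable X (t, u) (1, 0) by exact (@smooth_derivable _ _ _ Omega X (t, u) (1, 0) smooth_X It).
by have [_ <-] := is_derive_time_slice (derivableP d1).
Qed.

(** The velocity is smooth in space because it is the time derivative of the
    flow. *)
Let velocity_normal t : time_interval t -> normal_field p (F t) (velocity t).
Proof.
move=> It; have [t0 tT] := It; have [[sG nG tG] _] := gradient (ltW t0) tT.
split.
- move=> u _; exists setT, (velocity t \o p); split=> //; first exact: openT.
  have -> : velocity t \o p = (fun u => 'D_(1, 0) X (t, u)).
    by apply/funext => v; rewrite velocityE.
  have cs : continuous (fun u : R * R => (t, u)).
    move=> v; apply: (@cvg_pair _ _ _ (nbhs v) (nbhs t) (nbhs v) _ _ _ (cst t) id).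
      exact: cvg_cst.
    exact: cvg_id.
  have aff h v x : (t, h *: v + x) = h *: (0 : R, v : R * R) + (t, x : R * R).
    by congr (_, _); rewrite /= scaler0 add0r.
  have := smooth_on_open_affine aff cs 
    (smooth_on_open_derive ((1, 0) : R * (R * R)) smooth_X).
  by apply: smooth_on_openS => v _.
- by move=> x; rewrite dotNl dotZl nG mulr0 oppr0.
- by move=> u v; rewrite dotNl dotZl tG mulr0 oppr0.
Qed.

Let shifted_variation t : time_interval t ->
  smooth_variation p (F t) (velocity t) (fun e => F (t + e)).
Proof.
move=> It.
have /nbhs_ballP[d /= d0 dI] : nbhs t time_interval by exact: open_nbhs_nbhs.
have inI e : `|e| < d -> time_interval (t + e).
  by move=> ed; apply: dI; rewrite -ball_normE /= opprD addNKr normrN.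
exists d => //; split.
- rewrite (_ : (fun z => _) = X \o time_change ('X + t%:P)); last first.
    by apply/funext => z; rewrite /X /time_change /= !hornerE addrC.
  apply: smooth_on_time_change smooth_flow => z /= /inI.
  by rewrite !hornerE [z.1 + t]addrC => -[/ltW].
- by move=> e /inI[/ltW e0 eT]; exact: immersed.
- by rewrite addr0.
- by move=> x; exact: is_derive_shifted_flow.
Qed.

Let dissipation t :=
  \int[plane_measure]_(u in unit_square)
     (dot (G t (p u)) (velocity t (p u)) * area_density (F t \o p) u).

Let continuous_pairing t : time_interval t ->
  continuous (fun u => dot (G t (p u)) (velocity t (p u))).
Proof.
move=> It; have [sV _ _] := velocity_normal It.
have [[sG _ _] _] := gradient (ltW It.1) It.2.
have cont h : smooth_on setT (h \o p) -> continuous (h \o p : R * R -> 'rV[R]_4).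
  by move=> /(smooth_on_openP openT) sh u; exact: smooth_continuous sh _.
by move=> u; exact (continuous_dot (cont _ sG u) (cont _ sV u)).
Qed.

(** The flow itself, with the origin of time moved to [t], is a variation of
    [F t] by which the gradient can be tested. *)
Let is_derive_willmore t : time_interval t -> is_derive (t : R) (1 : R) W (dissipation t).
Proof.
move=> It; have [_ grad] := gradient (ltW It.1) It.2.
have := grad _ (velocity_normal It) _ (shifted_variation It).
have mh : measurable_fun setT (fun x : borel S => dot (G t x) (velocity t x)).
  apply: continuous_borel_measurable; apply: (continuous_from_covering hp).
  exact: continuous_pairing.
have ca := immersion_continuous_area (immersed (ltW It.1) It.2).
rewrite (integral_area_measure hp ca mh) => dW.
apply: (@is_derive_transport _ _ _ _ (fun e => W (t + e)) W 0 1 t 1) dW.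
by move=> h; rewrite addr0 addrC.
Qed.

Let continuous_dissipation_density t : time_interval t ->
  continuous (fun u => dot (G t (p u)) (velocity t (p u)) * area_density (F t \o p) u).
Proof.
move=> It u; have ca := immersion_continuous_area (immersed (ltW It.1) It.2).
have h := continuous_mulr (@continuous_pairing t It u) (ca u).
exact h.
Qed.

Let dissipation_le0 t : time_interval t -> dissipation t <= 0.
Proof.
move=> It; rewrite -oppr_ge0 -mulN1r /dissipation -RintegralZl; last 2 first.
- exact: measurable_unit_square.
- exact: integrable_continuous (continuous_dissipation_density It).
apply: Rintegral_ge0 => u _; rewrite mulN1r -mulNr mulr_ge0 ?sqrtr_ge0//.
by rewrite /velocity dotNr dotZr opprK mulr_ge0 ?dot_ge0// invr_ge0 sqr_ge0.
Qed.

Let gram_gt0_flow t u : Omega (t, u) -> 0 < gram (fun u => X (t, u)) u.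
Proof. by move=> It; exact: (immersion_gram_gt0 (immersed (ltW It.1) It.2)). Qed.

Let normal_velocity (z : R * (R * R)) v : Omega z ->
  dot ('D_(1, 0) X z) ('D_(0, v) X z) = 0.
Proof.
case: z => t u It; rewrite velocityE//.
have [_ _ tV] := velocity_normal It.
have -> : 'D_(0, v) X (t, u) = 'D_v (F t \o p) u.
  apply/esym; apply: derive_transport => h.
  by congr (X (_, _)); rewrite /= scaler0 add0r.
exact: tV.
Qed.

Let rateE t u : time_interval t -> area_density_rate X (t, u) =
  - dot (velocity t (p u)) (mean_curvature (F t \o p) u) * area_density (F t \o p) u.
Proof.
move=> It; have [_ nV _] := velocity_normal It.
have n0 : dot ('D_(1, 0) X (t, u)) (X (t, u)) = 0 by rewrite velocityE//; exact: nV.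
have E := @area_density_rateE R Omega X open_Omega smooth_X gram_gt0_flow normal_velocity
  t u It n0.
by rewrite velocityE// in E.
Qed.

Let continuous_rate z : Omega z -> {for z, continuous (area_density_rate X)}.
Proof. exact (@continuous_area_density_rate R Omega X smooth_X gram_gt0_flow z). Qed.

Let is_derive_area t u : time_interval t ->
  is_derive (t : R) (1 : R) (fun s => area_density (F s \o p) u) (area_density_rate X (t, u)).
Proof.
by move=> It; exact (@is_derive_area_density R Omega X smooth_X gram_gt0_flow t u It).
Qed.

Let weighted_area (sigma : R * R -> R) t :=
  \int[plane_measure]_(u in unit_square) (sigma u * area_density (F t \o p) u).

(** Differentiation under the integral: by compactness the rate of the area
    density is bounded on the closed square uniformly for times near [t]. *)
Let is_derive_weighted_area (sigma : R * R -> R) t : measurable_fun setT sigma ->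
  (forall u, `|sigma u| <= 1) -> time_interval t ->
  is_derive (t : R) (1 : R) (weighted_area sigma)
    (\int[plane_measure]_(u in unit_square) (sigma u * area_density_rate X (t, u))).
Proof.
move=> ms s1 It.
have /nbhs_ballP[d /= d0 dI] : nbhs t time_interval by exact: open_nbhs_nbhs.
pose a := t - d / 2; pose b := t + d / 2.
have abI s : a <= s <= b -> time_interval s.
  move=> /andP[h1 h2]; apply: dI; rewrite -ball_normE /= ltr_norml.
  by move: h1 h2; rewrite /a /b => h1 h2; apply/andP; split; lra.
have cK z : (`[a, b]%classic `*` closed_square) z -> {for z, continuous (area_density_rate X)}.
  by move=> [/=]; rewrite in_itv/= => /abI Iz _; exact: continuous_rate.
have [M M0 rM] := compact_bound (compact_setX (@segment_compact R a b) compact_closed_square) cK.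
pose f s u := sigma u * area_density (F s \o p) u.
have ooI s : `]a, b[%classic s -> a <= s <= b.
  by rewrite /= in_itv/= => /andP[h1 h2]; rewrite !ltW.
have ta : `]a, b[%classic t.
  by rewrite /= in_itv/= /a /b; apply/andP; split; lra.
have df s u : `]a, b[%classic s ->
    is_derive (s : R) (1 : R) (f ^~ u) (sigma u * area_density_rate X (s, u)).
  move=> /ooI/abI Is; have ds := is_derive_area u Is.
  by apply: is_derive_eq; rewrite /GRing.scale.
have intf s : `]a, b[%classic s -> plane_measure.-integrable unit_square (EFin \o f s).
  move=> /ooI/abI Is; apply: integrable_bounded_continuous => //.
  exact: immersion_continuous_area (immersed (ltW Is.1) Is.2).
have derf s u : `]a, b[%classic s -> unit_square u -> derivable (f ^~ u) s 1.
  by move=> Is _; have [] := df s u Is.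
have intM : plane_measure.-integrable unit_square (EFin \o (fun=> M)).
  by apply: integrable_continuous => u; exact: cst_continuous.
have boundM s u : `]a, b[%classic s -> unit_square u -> `|partial1of2 f s u| <= M.
  move=> Is uQ; rewrite partial1of2E; have [_ ->] := df s u Is.
  rewrite normrM -[leRHS]mul1r ler_pM//; apply: rM; split; last exact: unit_square_closed.
  by rewrite /= in_itv/=; exact: ooI.
split.
  exact (@derivable_under_integral R _ _ plane_measure f unit_square measurable_unit_square
    t a b ta intf derf (fun=> M) (fun=> M0) intM boundM).
rewrite -derive1E.
apply: etrans (@differentiation_under_integral R _ _ plane_measure f unit_square
  measurable_unit_square t a b ta intf derf (fun=> M) (fun=> M0) intM boundM) _.
apply: eq_Rintegral => u _; rewrite partial1of2E.
by have [_ ->] := df t u ta.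
Qed.

Variable c0 : R.
Hypothesis c0_gt0 : 0 < c0.
Hypothesis c0_le : forall t x, time_interval t -> c0 <= sqA0 p (F t) x.

(** With [a = sqA0] the velocity is [- a^-2 G], so the left-hand side is
    [a^-4 |G|^2], the pairing on the right is [- a^-2 |G|^2], and [a >= c0]. *)
Let speed_le t x : time_interval t ->
  dot (velocity t x) (velocity t x) <= c0 ^- 2 * - dot (G t x) (velocity t x).
Proof.
move=> It; rewrite /velocity !dotNr !dotNl !dotZr !dotZl !opprK.
rewrite ler_wpM2r ?mulr_ge0 ?dot_ge0 ?invr_ge0 ?sqr_ge0//.
rewrite lef_pV2 ?posrE ?exprn_gt0//; last by rewrite (lt_le_trans c0_gt0)// c0_le.
by rewrite ler_sqr ?nnegrE ?c0_le// ltW// (lt_le_trans c0_gt0)// c0_le.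
Qed.

(** The weighted arithmetic-geometric mean inequality with weight [l / c0] for
    the first variation [- dot v H] of area. The curvature term is at most four
    times the integrand [1 + |H|^2 / 4] of the energy, and the velocity term is
    controlled by the dissipation. *)
Let rate_le (l : R) t u : 0 < l -> time_interval t ->
  `|area_density_rate X (t, u)| <=
  2 * l / c0 * willmore_density p (F t) u
  + - (2 * c0 * l)^-1 * (dot (G t (p u)) (velocity t (p u)) * area_density (F t \o p) u).
Proof.
move=> l0 It; rewrite rateE// mulNr normrN normrM [`|area_density _ _|]ger0_norm ?sqrtr_ge0//.
rewrite /willmore_density !mulrA -mulrDl ler_wpM2r ?sqrtr_ge0// dotC.
have lc : 0 < l / c0 by rewrite divr_gt0.
have amgm := dot_amgm (mean_curvature (F t \o p) u) (velocity t (p u)) lc.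
have sp := speed_le (p u) It.
have sp' : (l / c0)^-1 * dot (velocity t (p u)) (velocity t (p u)) <=
    (l / c0)^-1 * (c0 ^- 2 * - dot (G t (p u)) (velocity t (p u))).
  by rewrite ler_wpM2l// invr_ge0 ltW.
apply: le_trans amgm _.
have c0' : c0 != 0 by rewrite gt_eqF.
have l0' : l != 0 by rewrite gt_eqF.
move: sp'; set q := dot (mean_curvature _ _) _; set r := dot (G _ _) _; set v := dot _ _.
have -> : (l / c0)^-1 * (c0 ^- 2 * - r) = 2 * (- (2 * c0 * l)^-1 * r).
  by field; rewrite l0'.
have -> : 2 * l / c0 * (1 + q / 4) = 2 * (l / c0) + (l / c0 * q) / 2 by field.
move=> h; move: lc h; set x := l / c0; set y := x^-1 * v; set z := - _ * r.
move: (x * q) => xq; move=> *; lra.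
Qed.

Let weighted_rate_le (sigma : R * R -> R) (l : R) t : measurable_fun setT sigma ->
  (forall u, `|sigma u| <= 1) -> 0 < l -> time_interval t ->
  `|\int[plane_measure]_(u in unit_square) (sigma u * area_density_rate X (t, u))| <=
  2 * l / c0 * W t - (2 * c0 * l)^-1 * dissipation t.
Proof.
move=> ms s1 l0 It.
have imm := immersed (ltW It.1) It.2.
have mQ := @measurable_unit_square R.
have cr : continuous (fun u => area_density_rate X (t, u)).
  move=> u; apply: (@continuous_comp _ _ _ (fun u => (t, u)) (area_density_rate X)).
    apply: (@cvg_pair _ _ _ (nbhs u) (nbhs t) (nbhs u) _ _ _ (cst t) id).
      exact: cvg_cst.
    exact: cvg_id.
  exact: continuous_rate.
have isr := integrable_bounded_continuous ms s1 cr.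
have h := @le_normr_Rintegral _ _ R plane_measure _ (fun u => sigma u * _) mQ isr.
apply: (le_trans h).
have iw : plane_measure.-integrable unit_square (EFin \o willmore_density p (F t)).
  exact: integrable_continuous (continuous_willmore_density imm).
have idis := integrable_continuous (continuous_dissipation_density It).
have iw' := integrableZl mQ (2 * l / c0) iw.
have id' := integrableZl mQ (- (2 * c0 * l)^-1) idis.
rewrite -mulNr /W (willmoreE hp imm) /dissipation -(RintegralZl _ mQ iw).
rewrite -(RintegralZl _ mQ idis) -RintegralD//.
apply: le_Rintegral => //.
- exact (integrable_abse isr).
- exact (integrableD mQ iw' id').
move=> u _; rewrite normrM; apply: le_trans (rate_le u l0 It).
by rewrite -[leRHS]mul1r ler_wpM2r.
Qed.

Let willmore_nonincreasing s t : time_interval s -> s <= t -> time_interval t -> W t <= W s.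
Proof.
move=> Is st It; apply: (@derive_nonincreasing _ W dissipation) => // r /andP[sr rt].
have Ir : time_interval r.
  by split; [exact: lt_le_trans Is.1 sr|apply: le_lt_trans It.2; rewrite lee_fin].
by split; [exact: is_derive_willmore|exact: dissipation_le0].
Qed.

Let small_times : exists2 d : R, 0 < d & forall e : R, `|e| < d -> ((e ^+ 2)%:E < T)%E.
Proof.
have [r r0 rT] : exists2 r : R, 0 < r & (r%:E <= T)%E.
  case: T T_gt0 => [r| |] //= h; last by exists 1 => //; rewrite leey.
  by exists r.
exists (Num.min 1 r); first by rewrite lt_min ltr01.
move=> e; rewrite lt_min => /andP[e1 er]; apply: lt_le_trans rT.
rewrite lte_fin; apply: le_lt_trans er.
by rewrite -(ger0_norm (sqr_ge0 e)) expr2 normrM ler_piMl// ltW.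
Qed.

(** At the initial time the flow exists on one side only, while a variation is
    two-sided. Substituting [e ^ 2] for the time gives a variation of [F 0]
    through the surfaces of the flow, whose velocity is zero. *)
Let squared_variation : smooth_variation p (F 0) (fun=> 0) (fun e => F (e ^+ 2)).
Proof.
have [d d0 dT] := small_times; exists d => //; split.
- rewrite (_ : (fun z => _) = X \o time_change ('X^2)); last first.
    by apply/funext => z; rewrite /X /time_change /= !hornerE.
  apply: smooth_on_time_change smooth_flow => z /= /dT.
  by rewrite !hornerE sqr_ge0.
- by move=> e /dT eT; apply: immersed => //; exact: sqr_ge0.
- by rewrite expr0n.
- move=> x.
  have T0 : ((0 : R)%:E < T)%E by [].
  have ev := @evolution 0 (lexx 0) T0 x.
  (* The difference quotient of e |-> F (e ^ 2) at 0 is h times the quotient Q of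
     F at h ^ 2, and Q converges by the evolution equation. *)
  pose Q (k : R) := k^-1 *: (F (0 + k) x - F 0 x).
  have Qsq : Q (h ^+ 2) @[h --> (0 : R)^'] --> - (sqA0 p (F 0) x ^- 2 *: G 0 x).
    move=> P /ev nP.
    have [r /= r0 rP] : nbhs_ball (0 : R) [set k | k != 0 -> 0 <= 0 + k -> P (Q k)].
      exact/nbhs_ballP.
    change (\forall h \near (0 : R)^', P (Q (h ^+ 2))).
    near=> h; apply: rP; last by rewrite add0r sqr_ge0.
    - rewrite -ball_normE /= sub0r normrN expr2 normrM.
      have h1 : `|h| < 1 by near: h; exact: dnbhs0_lt.
      have hr : `|h| < r by near: h; exact: dnbhs0_lt.
      by apply: le_lt_trans hr; rewrite ler_piMl// ltW.
    - by rewrite sqrf_eq0; near: h; exact: nbhs_dnbhs_neq.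
  have e0 : (h : R) @[h --> (0 : R)^'] --> (0 : R).
    by apply: cvg_trans (@cvg_id _ (nbhs (0 : R))); exact: cvg_within.
  have := cvgZ e0 Qsq; rewrite scale0r.
  rewrite (_ : (fun h => h *: Q (h ^+ 2)) =
    (fun h : R => h^-1 *: (((fun e => F (e ^+ 2) x) \o shift 0) (h *: (1 : R)) - F (0 ^+ 2) x))).
    move=> /(_ _) cv; split; first by apply/cvg_ex; exists 0; exact cv.
    by apply/cvg_lim => //; exact cv.
  apply/funext => h; rewrite /Q /= [h *: 1]mulr1 addr0 add0r expr0n /= scalerA.
  congr (_ *: _); have [->|h0] := eqVneq h 0; first by rewrite mul0r invr0.
  by rewrite expr2 invfM mulrA mulfV// mul1r.
Unshelve. all: end_near. Qed.

(** The energy is differentiable along [squared_variation], hence right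
    continuous at time zero, and it decreases at positive times. *)
Let willmore_initial t : time_interval t -> W t <= W 0.
Proof.
move=> It; have [_ grad] := gradient (lexx 0) T_gt0.
have zero_field : normal_field p (F 0) (fun=> 0).
  split=> [u _|x|u v]; rewrite ?dot0l//.
  have E vs : iter_derive vs ((fun=> 0) \o p : R * R -> 'rV[R]_4) = cst 0.
    by elim: vs => //= v vs ->; apply/funext => y; exact: derive_cst.
  exists setT, ((fun=> 0) \o p); split => //; first exact: openT.
  move=> vs y _; rewrite E; split; first by move=> v; exact: derivable_cst.
  exact: cst_continuous.
have [dW _] := grad _ zero_field _ squared_variation.
have cW : {for 0, continuous (fun e : R => W (e ^+ 2))}.
  by apply: differentiable_continuous; exact/derivable1_diffP.
apply: (@initial_value_bound R W t It.1 cW) => r r0 rt.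
apply: willmore_nonincreasing => //; split => //.
by apply: le_lt_trans It.2; rewrite lee_fin.
Qed.

(** One estimate for all weights [sigma] bounded by one; both the total variation
    and the measure of a Borel set are of this form. *)
Lemma weighted_area_estimate (sigma : R * R -> R) s t : measurable_fun setT sigma ->
  (forall u, `|sigma u| <= 1) -> 0 < s -> s < t -> (t%:E < T)%E ->
  `|weighted_area sigma t - weighted_area sigma s| <=
  2 * Num.sqrt (W 0) / c0 * Num.sqrt ((t - s) * (W s - W t)).
Proof.
move=> ms s1 s0 st tT.
have Ir r : s <= r <= t -> time_interval r.
  move=> /andP[sr rt]; split; first exact: lt_le_trans s0 sr.
  by apply: le_lt_trans tT; rewrite lee_fin.
have Is : time_interval s by apply: Ir; rewrite lexx ltW.
have It : time_interval t by apply: Ir; rewrite lexx ltW.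
have Wst : W t <= W s by apply: willmore_nonincreasing => //; exact: ltW.
have W0 : 0 <= W 0.
  apply: le_trans (willmore_initial It); rewrite /W (willmoreE hp (immersed (ltW It.1) It.2)).
  apply: Rintegral_ge0 => u _; rewrite mulr_ge0 ?sqrtr_ge0//.
  by rewrite addr_ge0// divr_ge0// dot_ge0.
apply: (dissipation_estimate c0_gt0 W0 st Wst) => r /Ir Jr; split.
- exact: is_derive_weighted_area ms s1 Jr.
- exact: is_derive_willmore Jr.
- exact: willmore_initial Jr.
- by move=> l l0; exact: weighted_rate_le ms s1 l0 Jr.
Qed.

End Flow.

(** * Total variation and Borel sets *)
Lemma fin_dist_le {R : realType} (a b : \bar R) (a' b' C : R) :
  a = a'%:E -> b = b'%:E -> `|a' - b'| <= C -> (`|a - b| <= C%:E)%E.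
Proof. by move=> -> -> h; rewrite -EFinB lee_fin. Qed.

Section Estimates.
Context {R : realType} {S : ptopologicalType} (p : R * R -> S).
Hypothesis hp : torus_covering p.

(** A continuous test function [psi] on the torus is the weight [psi \o p] in the
    covering. *)
Lemma TV_dist_le (f g : S -> 'rV[R]_4) (C : R) :
  immersion p f -> immersion p g ->
  (forall sigma : R * R -> R, measurable_fun setT sigma -> (forall u, `|sigma u| <= 1) ->
    `|\int[plane_measure]_(u in unit_square) (sigma u * area_density (f \o p) u)
      - \int[plane_measure]_(u in unit_square) (sigma u * area_density (g \o p) u)| <= C) ->
  (TV_dist (area_measure p f) (area_measure p g) <= C%:E)%E.
Proof.
move=> If Ig h; apply: ge_ereal_sup => _ [psi [cpsi psi1] <-].
have mpsi := continuous_borel_measurable cpsi.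
have ms := measurable_lift hp mpsi.
have cf := immersion_continuous_area If; have cg := immersion_continuous_area Ig.
have s1 u : `|(psi \o p) u| <= 1 by exact: psi1.
have mQ := @measurable_unit_square R.
have Ff := integrable_fin_num mQ (integrable_bounded_continuous ms s1 cf).
have Fg := integrable_fin_num mQ (integrable_bounded_continuous ms s1 cg).
exact (fin_dist_le (etrans (integral_area_measure hp cf mpsi) (esym (fineK Ff)))
  (etrans (integral_area_measure hp cg mpsi) (esym (fineK Fg))) (h (psi \o p) ms s1)).
Qed.

(** The weight is the indicator of the preimage of [B]. *)
Lemma area_measure_dist_le (f g : S -> 'rV[R]_4) (C : R) (B : set (borel S)) :
  measurable B -> immersion p f -> immersion p g ->
  (forall sigma : R * R -> R, measurable_fun setT sigma -> (forall u, `|sigma u| <= 1) ->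
    `|\int[plane_measure]_(u in unit_square) (sigma u * area_density (f \o p) u)
      - \int[plane_measure]_(u in unit_square) (sigma u * area_density (g \o p) u)| <= C) ->
  (`| area_measure p f B - area_measure p g B | <= C%:E)%E.
Proof.
move=> mB If Ig h.
have mB1 : measurable_fun setT (\1_B : borel S -> R) by exact: measurable_indic.
have ms := measurable_lift hp mB1.
have cf := immersion_continuous_area If; have cg := immersion_continuous_area Ig.
have s1 u : `|(\1_B \o p : R * R -> R) u| <= 1.
  by rewrite /= indicE; case: (_ \in _); rewrite ?normr1 ?normr0.
have mQ := @measurable_unit_square R.
have Ff := integrable_fin_num mQ (integrable_bounded_continuous ms s1 cf).
have Fg := integrable_fin_num mQ (integrable_bounded_continuous ms s1 cg).
exact (fin_dist_le (etrans (area_measure_indicator p f mB) (esym (fineK Ff)))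
  (etrans (area_measure_indicator p g mB) (esym (fineK Fg))) (h (\1_B \o p) ms s1)).
Qed.

End Estimates.

Theorem proposition3p3 (R : realType) (Sigma : ptopologicalType)
    (p : R * R -> Sigma) (hp : torus_covering p)
    (T : \bar R) (hT : (0 < T)%E)
    (F : R -> Sigma -> 'rV[R]_4) (hF : is_MIWF p T F)
    (c0 : R) (hc0 : 0 < c0)
    (hA0 : (c0%:E <= ereal_inf
              [set ereal_inf [set (sqA0 p (F t) x)%:E | x in [set: Sigma]] |
                 t in [set t : R | (0 < t)%R /\ t%:E < T]])%E) :
  let mu := fun t : R => area_measure p (F t) in
  let W := fun t : R => willmore p (F t) in
  let W0 := W 0 in
  let estimates := fun C : R =>
    forall s t : R, 0 < s -> s < t -> (t%:E < T)%E ->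
      (TV_dist (mu t) (mu s)
         <= (C * Num.sqrt ((t - s) * (W s - W t)))%:E)%E /\
      (forall B : set (borel Sigma), measurable B ->
         (`| mu t B - mu s B |
            <= (C * Num.sqrt ((t - s) * (W s - W t)))%:E)%E) in
  estimates (2 * Num.sqrt W0 / c0) /\
  (W0 <= 8 * pi -> estimates (Num.sqrt (32 * pi) / c0)).
Proof.
move=> mu W W0 estimates.
have [smooth_flow imm [G gradG]] := hF.
have immersed t t0 tT := (imm t t0 tT).1.
have gradient t t0 tT := (gradG t t0 tT).1.
have evolution t t0 tT := (gradG t t0 tT).2.
have c0_le t x : [set t : R | 0 < t /\ (t%:E < T)%E] t -> c0 <= sqA0 p (F t) x.
  move=> It; rewrite -lee_fin; apply: (le_trans hA0).
  apply: (@le_trans _ _ (ereal_inf [set (sqA0 p (F t) x)%:E | x in [set: Sigma]])).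
    by apply: ereal_inf_lbound; exists t.
  by apply: ereal_inf_lbound; exists x.
have sqrt_bound := weighted_area_estimate hp hT smooth_flow immersed gradient evolution hc0 c0_le.
have first_estimate : estimates (2 * Num.sqrt W0 / c0).
  move=> s t s0 st tT.
  have It := immersed t (ltW (lt_trans s0 st)) tT.
  have sT : (s%:E < T)%E by apply: lt_trans tT; rewrite lte_fin.
  have Is := immersed s (ltW s0) sT.
  split=> [|B mB].
    by apply: TV_dist_le => // sigma ms s1; exact: sqrt_bound.
  by apply: area_measure_dist_le => // sigma ms s1; exact: sqrt_bound.
split=> // W0_le s t s0 st tT; have [tv borel_est] := first_estimate s t s0 st tT.
have le_const : 2 * Num.sqrt W0 / c0 * Num.sqrt ((t - s) * (W s - W t)) <=
    Num.sqrt (32 * pi) / c0 * Num.sqrt ((t - s) * (W s - W t)).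
  have -> : Num.sqrt (32 * pi) = 2 * Num.sqrt (8 * pi) :> R.
    have -> : 32 * pi = 2 ^+ 2 * (8 * pi) :> R by ring.
    by rewrite (sqrtrM _ (sqr_ge0 2)) sqrtr_sqr ger0_norm.
  apply: ler_wpM2r; first exact: sqrtr_ge0.
  apply: ler_wpM2r; first by rewrite invr_ge0 ltW.
  by apply: ler_wpM2l => //; exact: ler_wsqrtr.
by split=> [|B mB]; [apply: le_trans tv _|apply: le_trans (borel_est B mB) _];
  rewrite lee_fin.
Qed.
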